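(* Let $d\ge 1$ be an integer, $h\in(0,1]$, $C>0$ and $M>0$. Then the sequence $a_n=n^{-\frac{2h}{2h+d}}$ is the optimal minimax rate of convergence on the class $\mathcal{D}^{(h,C,M)}$, i.e. $$\liminf_{n\to\infty}\ \inf_{\hat F_n}\ \sup_{P\in\mathcal{D}^{(h,C,M)}}\frac{\mathbb{E}_{D_n\sim P^n}[R_P(\hat F_n)]-R_P(F^\ast)}{n^{-\frac{2h}{2h+d}}}>0$$ and $$\limsup_{n\to\infty}\ \inf_{\hat F_n}\ \sup_{P\in\mathcal{D}^{(h,C,M)}}\frac{\mathbb{E}_{D_n\sim P^n}[R_P(\hat F_n)]-R_P(F^\ast)}{n^{-\frac{2h}{2h+d}}}<\infty,$$ where the infimum is over all distributional regression models $\hat F_n$ trained on $D_n$.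
   Context: Setting: $(X,Y)\in\mathbb{R}^d\times\mathbb{R}$ is a random pair with distribution $P$, $P_X$ is the marginal law of $X$, and $F^\ast_x(y)=P(Y\le y\mid X=x)$ is the conditional distribution function of $Y$ given $X=x$ (a version of it). The training sample is $D_n=\{(X_i,Y_i),1\le i\le n\}\sim P^n$ (i.i.d. with law $P$), independent of the test pair $(X,Y)\sim P$. A distributional regression model (predictor) $\hat F_n$ is a (measurable) map assigning to the training sample $D_n$ and to each $x\in\mathbb{R}^d$ a distribution function $\hat F_{n,x}$ on $\mathbb{R}$. For a distribution function $F$ and $y\in\mathbb{R}$, $\mathrm{CRPS}(F,y)=\int_{\mathbb{R}}(F(z)-\mathbf{1}_{y\le z})^2\,dz$. The risk of a predictor $\hat F:x\mapsto\hat F_x$ is $R_P(\hat F)=\mathbb{E}_{(X,Y)\sim P}[\mathrm{CRPS}(\hat F_X,Y)]$. When $Y$ is integrable, the excess risk satisfies $\mathbb{E}_{D_n\sim P^n}[R_P(\hat F_n)]-R_P(F^\ast)=\mathbb{E}_{D_n\sim P^n,X\sim P_X}\left[\int_{\mathbb{R}}|\hat F_{n,X}(z)-F^\ast_X(z)|^2\,dz\right]$. For $h\in(0,1]$, $C>0$, $M>0$, $\mathcal{D}^{(h,C,M)}$ is the class of distributions $P$ of $(X,Y)$ such that: i) $X\in[0,1]^d$ $P_X$-a.s.; ii) for all $x\in[0,1]^d$, $\int_{\mathbb{R}}F^\ast_x(z)(1-F^\ast_x(z))\,dz\le M$; iii) $\|F^\ast_{x'}-F^\ast_x\|_{L^2}\le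 C\|x'-x\|^h$ for all $x,x'\in[0,1]^d$, where $\|\cdot\|_{L^2}$ is the norm of $L^2(\mathbb{R})$ (Lebesgue measure) and $\|\cdot\|$ is the Euclidean norm. *)

(* Defs.v *)
From HB Require Import structures.
From mathcomp Require Import all_boot all_order all_algebra.
From mathcomp Require Import all_classical all_reals all_analysis.

Set Implicit Arguments.
Unset Strict Implicit.
Unset Printing Implicit Defensive.
Import Order.TTheory GRing.Theory Num.Def Num.Theory.
Import numFieldNormedType.Exports.

Local Open Scope classical_set_scope.
Local Open Scope ring_scope.
Local Open Scope ereal_scope.

(* Points of R^d are d-tuples, since tuples carry the product sigma-algebra. *)

Definition enorm {R : realType} {d : nat} (x : d.-tuple R) : R :=
  Num.sqrt (\sum_(i < d) tnth x i ^+ 2)%R.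

Definition tsub {R : realType} {d : nat} (x y : d.-tuple R) : d.-tuple R :=
  [tuple (tnth x i - tnth y i)%R | i < d].

Definition unit_cube (R : realType) (d : nat) : set (d.-tuple R) :=
  [set x | forall i, (0 <= tnth x i <= 1)%R].

Definition cons_tuple dT {T : measurableType dT} {n : nat}
  (xt : T * n.-tuple T) : n.+1.-tuple T := [the n.+1.-tuple T of xt.1 :: xt.2].

Lemma measurable_cons_tuple dT (T : measurableType dT) (n : nat) :
  measurable_fun [set: T * n.-tuple T] (@cons_tuple dT T n).
Proof. exact: measurable_cons. Qed.

HB.instance Definition _ dT (T : measurableType dT) (n : nat) :=
  isMeasurableFun.Build _ _ _ _ (@cons_tuple dT T n)
    (@measurable_cons_tuple dT T n).

HB.instance Definition _ d1 d2 (T1 : measurableType d1)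
    (T2 : measurableType d2) :=
  isMeasurableFun.Build _ _ _ _ (@fst T1 T2) measurable_fst.

(* The product measure P^n; [sample_lawE] checks it on boxes. *)
Fixpoint sample_law dT {T : measurableType dT} {R : realType}
    (P : probability T R) (n : nat) : probability (n.-tuple T) R :=
  match n with
  | 0 => \d_([tuple] : 0.-tuple T)
  | m.+1 => distribution (P \x sample_law P m) (@cons_tuple dT T m)
  end.

Lemma sample_lawE dT (T : measurableType dT) (R : realType)
    (P : probability T R) (n : nat) (A : 'I_n -> set T) :
  (forall i, measurable (A i)) ->
  sample_law P n [set t | forall i, A i (tnth t i)] = \prod_(i < n) P (A i).
Proof.
elim: n A => [|n IHn] A mA.
  rewrite big_ord0 /= diracE mem_set//= => -[]//.
rewrite big_ord_recl -(IHn (fun i => A (lift ord0 i)))//=.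
rewrite /distribution /pushforward -product_measure1E//; last first.
  rewrite (_ : [set t | _] =
      \bigcap_(i in [set: 'I_n]) (@tnth n T ^~ i) @^-1` A (lift ord0 i)).
    apply: fin_bigcap_measurable => // i _.
    by rewrite -[X in measurable X]setTI; exact: measurable_tnth.
  by apply/seteqP; split=> t /= h i; [move=> _|]; exact: h.
congr (_ _); apply/seteqP; split=> [[x t]/= h|[x t]/= [Ax At] i].
  split; first by have := h ord0; rewrite tnth0.
  by move=> i; have := h (lift ord0 i); rewrite tnthS.
by case: (unliftP ord0 i) => [j ->|->]; [rewrite tnthS; exact: At|rewrite tnth0].
Qed.

(* Distribution functions on the real line are [cumulativeBounded 0 1]:
   nondecreasing, right-continuous, with limits 0 at -oo and 1 at +oo. *)
Definition is_cond_cdf {R : realType} {d : nat}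
    (P : probability (d.-tuple R * R)%type R)
    (F : d.-tuple R -> cumulativeBounded (0 : R)%R (1 : R)%R) :=
  (forall y, measurable_fun [set: d.-tuple R] (fun x => F x y)) /\
  (forall (A : set (d.-tuple R)) y, measurable A ->
     P (A `*` `]-oo, y]) = \int[distribution P fst]_(x in A) (F x y)%:E).

Definition crps {R : realType} (F : R -> R) (y : R) : \bar R :=
  \int[lebesgue_measure]_z (((F z - (y <= z)%R%:R) ^+ 2)%R)%:E.

Definition risk {R : realType} {d : nat}
    (P : probability (d.-tuple R * R)%type R)
    (F : d.-tuple R -> cumulativeBounded (0 : R)%R (1 : R)%R) : \bar R :=
  \int[P]_xy crps (F xy.1) xy.2.

Definition predictors (R : realType) (d n : nat) :
    set (n.-tuple (d.-tuple R * R) ->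
         d.-tuple R -> cumulativeBounded (0 : R)%R (1 : R)%R) :=
  [set Fhat | forall z,
     measurable_fun [set: n.-tuple (d.-tuple R * R) * d.-tuple R]
       (fun u => Fhat u.1 u.2 z)].

Definition expected_risk {R : realType} {d n : nat}
    (P : probability (d.-tuple R * R)%type R)
    (Fhat : n.-tuple (d.-tuple R * R) ->
            d.-tuple R -> cumulativeBounded (0 : R)%R (1 : R)%R) : \bar R :=
  \int[sample_law P n]_D risk P (Fhat D).

(* Conditional distribution functions are only determined up to P_X-null sets:
   P is in the class when some version satisfies the pointwise conditions. *)
Definition holder_class (R : realType) (d : nat) (h C M : R) :
    set (probability (d.-tuple R * R)%type R) :=
  [set P | {ae distribution P fst, forall x, unit_cube x} /\
    exists F, [/\ is_cond_cdf P F,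
      forall x, unit_cube x ->
        \int[lebesgue_measure]_z (F x z * (1 - F x z))%:E <= M%:E &
      forall x x', unit_cube x -> unit_cube x' ->
        'N[lebesgue_measure]_2%:E[EFin \o (fun z => F x' z - F x z)%R]
          <= (C * enorm (tsub x' x) `^ h)%:E]].

(* The inner supremum ranges over P in the class and over all versions Fstar
   of its conditional distribution function: [risk P Fstar] does not depend
   on the version, and is at most M on [holder_class h C M], so that the
   extended-real subtraction is never +oo - +oo. *)
Definition minimax_ratio {R : realType} {d : nat}
    (Dclass : set (probability (d.-tuple R * R)%type R))
    (a : nat -> R) (n : nat) : \bar R :=
  ereal_inf [set ereal_sup [set r | exists P Fstar,
      [/\ Dclass P, is_cond_cdf P Fstar &
          r = (expected_risk P Fhat - risk P Fstar) / (a n)%:E]]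
    | Fhat in @predictors R d n].

(* Main.v *)
Require Import Defs.
From HB Require Import structures.
From mathcomp Require Import all_boot all_order all_algebra.
From mathcomp Require Import all_classical all_reals all_analysis.
From mathcomp Require Import measurable_realfun ring lra.

Set Implicit Arguments.
Unset Strict Implicit.
Unset Printing Implicit Defensive.
Import Order.TTheory GRing.Theory Num.Def Num.Theory.
Import numFieldNormedType.Exports.

Local Open Scope classical_set_scope.
Local Open Scope ring_scope.
Local Open Scope ereal_scope.

(* Excess risk.  For a version F of the conditional distribution function, the
   excess risk of a predictor Fhat is the integral over z of E (Fhat - F)^2.

   Upper bound.  Cut the unit cube into about m^d cells of side 1/m and let
   Fhat_x be the empirical distribution function of the outputs whose input lies
   in the cell of x, one observation being counted once more so that the weights
   w_i always sum to 1.  Given the inputs, the errors 1(Y_i <= z) - F_{X_i}(z)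
   are centred and uncorrelated, so the risk splits into a squared bias, at most
   C^2 (sqrt d / m)^(2h) + O(1 / (N + 1)), and a variance, at most
   M sum_i w_i^2 <= 2 M / (N + 1), where N is the number of inputs in the cell.
   A cell of probability p has E [1 / (N + 1)] <= 1 / ((n + 1) p), hence a total
   error O(m^(-2h) + m^d / n), which is of the announced order for
   m ~ n^(1 / (2h + d)).

   Lower bound.  Put the inputs uniformly on the m^d nodes of a grid and the
   outputs in {0, M}, with probability 1/2 or 1/2 + delta of being 0, freely
   chosen at each node, delta ~ m^(-h).  Hoelder extensions of these values keep
   the laws in the class.  Two laws differing at one node have chi-square
   distance bounded over n observations, so no predictor can guess the value at
   a constant fraction of the nodes, on average over all 2^(m^d) laws; each wrong
   guess costs a squared error of order delta^2 on the interval [0, M[. *)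

(** * Distribution functions *)

Section cdf.
Context {R : realType}.
Implicit Type F : cumulativeBounded (0 : R)%R (1 : R)%R.

Lemma cumulative01_ge0 F z : (0 <= F z)%R.
Proof.
have F0 := @cumulativeNy _ _ _ F.
rewrite leNgt; apply/negP => Fz.
have [y /= [yz]] : exists y, (y <= z /\ F z < F y)%R.
  have /cvgrPdist_lt/(_ (- F z)%R) := F0; rewrite oppr_gt0 => /(_ Fz) [M [_ HM]].
  exists (Num.min z (M - 1))%R; split; first by rewrite ge_min lexx.
  have /HM : (Num.min z (M - 1) < M)%R by rewrite gt_min ltrBlDr ltrDl ltr01 orbT.
  by rewrite sub0r normrN ltr_norml opprK => /andP[].
rewrite ltNge => /negP; apply.
exact: cumulative_is_nondecreasing.
Qed.

Lemma cumulative01_le1 F z : (F z <= 1)%R.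
Proof.
have F0 := @cumulativey _ _ _ F.
rewrite leNgt; apply/negP => Fz.
have [y /= [yz]] : exists y, (z <= y /\ F y < F z)%R.
  have /cvgrPdist_lt/(_ (F z - 1)%R) := F0; rewrite subr_gt0 => /(_ Fz) [M [_ HM]].
  exists (Num.max z (M + 1))%R; split; first by rewrite le_max lexx.
  have /HM : (M < Num.max z (M + 1))%R by rewrite lt_max ltrDl ltr01 orbT.
  by rewrite distrC ltr_norml => /andP[_]; rewrite ltrD2r.
rewrite ltNge => /negP; apply.
exact: cumulative_is_nondecreasing.
Qed.

Lemma cumulative01_lt_right_rat F z c : (F z < c)%R ->
  exists2 q : rat, (z < ratr q)%R & (F (ratr q) < c)%R.
Proof.
move=> Fzc; have e0 : (0 < (c - F z) / 2)%R by rewrite divr_gt0// subr_gt0.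
have [d] := nondecreasing_right_continuousP z F e0.
move=> Fd; have : (z < z + d%:num)%R by rewrite ltrDl.
move=> /rat_in_itvoo[q /[!in_itv]/= /andP[zq qd]].
exists q => //; apply: (@le_lt_trans _ _ (F (z + d%:num))%R).
  by apply: cumulative_is_nondecreasing; exact: ltW.
apply: le_lt_trans Fd _; rewrite -ltrBrDl ltr_pdivrMr// mulr_natr mulr2n.
by rewrite ltrDl subr_gt0.
Qed.

(* By monotonicity and right-continuity, [F s z < c] iff [F s q < c] for some
   rational [q > z]. *)
Lemma measurable_cumulative01_uncurry d (S : measurableType d)
    (F : S -> cumulativeBounded (0 : R)%R (1 : R)%R) :
  (forall z, measurable_fun [set: S] (fun s => F s z)) ->
  measurable_fun [set: S * R] (fun u => F u.1 u.2).
Proof.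
move=> mF; apply: (measurability _ (RGenInftyO.measurableE R)).
move=> _ [_ [c ->] <-]; rewrite setTI.
rewrite (_ : _ @^-1` _ = \bigcup_(q in [set: rat])
    (((fun s => F s (ratr q)) @^-1` `]-oo, c[) `*` `]-oo, (ratr q : R)[)); last first.
  apply/seteqP; split => -[s z].
    rewrite /= in_itv/=.
    move=> /cumulative01_lt_right_rat[q zq Fq]; by exists q.
  rewrite /= in_itv/=; move=> [q _ /= [/= Fq zq]]; move: Fq zq; rewrite !in_itv/= => Fq zq.
  by apply: le_lt_trans Fq; apply: cumulative_is_nondecreasing; exact: ltW.
apply: bigcupT_measurable_rat => q; apply: measurableX => //.
by rewrite -[X in measurable X]setTI; exact: mF.
Qed.
End cdf.

(** * Integration against samples *)

Section sample.
Context dT {T : measurableType dT} {R : realType} (P : probability T R).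

Lemma ge0_integral_sample_law_cons n (f : n.+1.-tuple T -> \bar R) :
  measurable_fun [set: n.+1.-tuple T] f -> (forall t, 0 <= f t) ->
  \int[sample_law P n.+1]_t f t =
  \int[P]_x \int[sample_law P n]_t f [tuple of x :: t].
Proof.
move=> mf f0; rewrite [LHS]ge0_integral_distribution//.
rewrite (@fubini_tonelli1 _ _ _ _ _ P (sample_law P n) (f \o @Defs.cons_tuple _ _ _))//.
- exact: measurableT_comp.
- by move=> x /=.
Qed.

Lemma ge0_integral_sample_law0 (f : 0.-tuple T -> \bar R) :
  measurable_fun [set: 0.-tuple T] f -> (forall t, 0 <= f t) ->
  \int[sample_law P 0]_t f t = f [tuple].
Proof. by move=> mf f0; rewrite integral_dirac// diracT mul1e. Qed.

End sample.

Lemma integral_indic_itv0 {R : realType} (a : R) : (0 <= a)%R ->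
  \int[lebesgue_measure]_t (\1_`[0%R, a[ t)%:E = a%:E.
Proof.
move=> a0; transitivity (lebesgue_measure `[0%R, a[%classic).
  by rewrite integral_indic// setIT.
rewrite lebesgue_measure_itv/= lte_fin.
case: ifPn => [_|]; first by rewrite sube0.
by rewrite -leNgt => a_le0; congr EFin; apply/eqP; rewrite eq_le a0.
Qed.

Lemma fubini_tonelli3 d1 d2 d3 (T1 : measurableType d1) (T2 : measurableType d2)
    (T3 : measurableType d3) (R : realType)
    (m1 : {sigma_finite_measure set T1 -> \bar R})
    (m2 : {sigma_finite_measure set T2 -> \bar R})
    (m3 : {sigma_finite_measure set T3 -> \bar R})
    (f : (T1 * T2) * T3 -> \bar R) :
  measurable_fun setT f -> (forall v, 0 <= f v) ->
  \int[m3]_z \int[m1]_x \int[m2]_y f ((x, y), z) =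
  \int[m2]_y \int[m3]_z \int[m1]_x f ((x, y), z).
Proof.
move=> mf f0.
transitivity (\int[m3]_z \int[m2]_y \int[m1]_x f ((x, y), z)).
  apply: eq_integral => z _.
  rewrite (fubini_tonelli (m1 := m1) (m2 := m2) (fun v => f (v, z)))//.
  exact: (measurableT_comp mf (pair2_measurable z)).
pose g (w : (T2 * T3) * T1) := f ((w.2, w.1.1), w.1.2).
have mg : measurable_fun setT g.
  apply: (measurableT_comp mf); apply: measurable_fun_pair => /=.
    by apply: measurable_fun_pair => //=; exact: (measurableT_comp (f := fst)).
  exact: (measurableT_comp (f := snd)).
rewrite (fubini_tonelli (m1 := m2) (m2 := m3) (fubini_F m1 g))//.
- by apply: measurable_fun_fubini_tonelli_F => // w; exact: f0.
- by move=> w; apply: integral_ge0 => x _; exact: f0.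
Qed.

Section integral_misc.
Context d {T : measurableType d} {R : realType}.

Lemma ge0_integral_layer_cake (m : {sigma_finite_measure set T -> \bar R})
    (A G : T -> R) :
  measurable_fun [set: T] A -> measurable_fun [set: T] G ->
  (forall x, (0 <= A x)%R) -> (forall x, (0 <= G x)%R) ->
  \int[m]_x (A x * G x)%:E =
  \int[lebesgue_measure]_t \int[m]_x (((0 <= t < A x)%R)%:R * G x)%:E.
Proof.
move=> mA mG A0 G0.
have mtA : measurable_fun [set: T * R]
    (fun u => ((0 <= u.2 < A u.1)%R%:R * G u.1)%:E : \bar R).
  apply/measurable_EFinP; apply: measurable_funM; last exact: measurableT_comp.
  rewrite (_ : (fun u : T * R => _) =
    (fun u => if (0 <= u.2 < A u.1)%R then 1%R else 0%R)); last first.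
    by apply/funext => u; case: ifP.
  apply: measurable_fun_ifT => //; apply: measurable_and.
    exact: measurable_fun_ler.
  by apply: measurable_fun_ltr => //; exact: measurableT_comp.
rewrite -(fubini_tonelli (m2 := lebesgue_measure) _ mtA)/=; last first.
  by move=> u; rewrite lee_fin mulr_ge0.
apply: eq_integral => x _.
rewrite (_ : (fun t => _) =
    (fun t => (G x)%:E * (\1_`[0%R, A x[ t)%:E)); last first.
  apply/funext => t; rewrite mulrC EFinM indicE; congr (_ * (_%:R)%:E).
  by rewrite mem_setE in_itv.
rewrite ge0_integralZl_EFin//; last first.
  by apply/measurable_EFinP; exact: measurable_indic.
by rewrite integral_indic_itv0// -EFinM mulrC.
Qed.

Lemma integral_cst_probability (Q : probability T R) (r : \bar R) :
  \int[Q]_x r = r.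
Proof. by rewrite integral_cst//= probability_setT mule1. Qed.

End integral_misc.

(** * Excess risk *)

Section conditional.
Context {R : realType} {d : nat} (P : probability (d.-tuple R * R)%type R).
Variable F : d.-tuple R -> cumulativeBounded (0 : R)%R (1 : R)%R.
Hypothesis PF : is_cond_cdf P F.

Lemma measurable_cond_cdf z : measurable_fun [set: d.-tuple R * R]
  (fun u => F u.1 z).
Proof. by apply: (measurableT_comp (PF.1 z)). Qed.

Lemma cond_cdf_indic (S : set (d.-tuple R)) z : measurable S ->
  \int[P]_u (\1_S u.1 * (u.2 <= z)%R%:R)%:E = \int[P]_u (\1_S u.1 * F u.1 z)%:E.
Proof.
move=> mS; transitivity (P (S `*` `]-oo, z])).
  rewrite -[in RHS](setIT (S `*` _)) -integral_indic//; last exact: measurableX.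
  apply: eq_integral => -[x y] _ /=; rewrite !indicE/= -natrM mulnb.
  congr (nat_of_bool _)%:R%:E; apply/andP/idP; rewrite !inE/= in_itv/=.
    by move=> [].
  by move=> [].
rewrite PF.2// integral_mkcond/= ge0_integral_distribution//.
- apply: eq_integral => -[x y] _ /=; rewrite patchE indicE.
  by case: ifPn; rewrite ?mul1r ?mul0r.
- apply/(measurable_restrictT (EFin \o F^~ z)) => //.
  by apply/measurable_EFinP; apply: measurable_funTS; exact: PF.1.
- move=> x. rewrite patchE; case: ifPn => // _; rewrite lee_fin; exact: cumulative01_ge0.
Qed.

Lemma measurable_snd_le z : measurable_fun [set: d.-tuple R * R]
  (fun u => (u.2 <= z)%R%:R : R).
Proof.
apply: (measurableT_comp (f := fun b : bool => b%:R : R)) => //.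
by apply: measurable_fun_ler.
Qed.

Lemma cond_cdf_indicC (S : set (d.-tuple R)) z : measurable S ->
  \int[P]_u (\1_S u.1 * (1 - (u.2 <= z)%R%:R))%:E =
  \int[P]_u (\1_S u.1 * (1 - F u.1 z))%:E.
Proof.
move=> mS.
have mI : measurable_fun [set: d.-tuple R * R] (fun u => \1_S u.1 : R).
  by apply: (@measurableT_comp _ _ _ _ _ _ (\1_S : d.-tuple R -> R) _ fst).
have split_ (G : d.-tuple R * R -> R) :
    measurable_fun [set: d.-tuple R * R] G -> (forall u, 0 <= G u <= 1)%R ->
    \int[P]_u (\1_S u.1)%:E = \int[P]_u (\1_S u.1 * G u)%:E +
      \int[P]_u (\1_S u.1 * (1 - G u))%:E.
  move=> mG G01; rewrite -ge0_integralD//.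
  - by apply: eq_integral => u _; rewrite -EFinD -mulrDr subrKC mulr1.
  - by move=> u _; rewrite lee_fin mulr_ge0//; case/andP: (G01 u).
  - by apply/measurable_EFinP; exact: measurable_funM.
  - by move=> u _; rewrite lee_fin mulr_ge0// subr_ge0; case/andP: (G01 u).
  - by apply/measurable_EFinP; apply: measurable_funM => //; exact: measurable_funB.
have := split_ _ (measurable_cond_cdf z)
  (fun u => introT andP (conj (cumulative01_ge0 (F u.1) z) (cumulative01_le1 (F u.1) z))).
rewrite (split_ (fun u => (u.2 <= z)%R%:R)%R (measurable_snd_le z)); last first.
  by move=> u; case: (u.2 <= z)%R; rewrite ?lexx ?ler01.
rewrite cond_cdf_indic//; set X := \int[P]_u (\1_S u.1 * F u.1 z)%:E.
suff X_fin : X \is a fin_num.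
  by rewrite ![X + _]addeC => /(congr1 (fun e => e - X)); rewrite !addeK.
rewrite ge0_fin_numE; last first.
  by apply: integral_ge0 => u _; rewrite lee_fin mulr_ge0// cumulative01_ge0.
apply: (@le_lt_trans _ _ (\int[P]_u cst 1 u)).
  apply: ge0_le_integral => //.
  - by move=> u _; rewrite lee_fin mulr_ge0// cumulative01_ge0.
  - by apply/measurable_EFinP; apply: measurable_funM => //; exact: measurable_cond_cdf.
  - move=> u _; rewrite lee_fin; apply: mulr_ile1; rewrite ?cumulative01_ge0 ?cumulative01_le1//.
rewrite integral_cst// mul1e.
exact: le_lt_trans (probability_le1 P measurableT) (ltry _).
Qed.

Lemma cond_cdf_integral (A B : d.-tuple R -> R) z :
  measurable_fun [set: d.-tuple R] A -> measurable_fun [set: d.-tuple R] B ->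
  (forall x, 0 <= A x)%R -> (forall x, 0 <= B x)%R ->
  \int[P]_u (A u.1 * (u.2 <= z)%R%:R + B u.1 * (1 - (u.2 <= z)%R%:R))%:E =
  \int[P]_u (A u.1 * F u.1 z + B u.1 * (1 - F u.1 z))%:E.
Proof.
move=> mA mB A0 B0.
have mA1 : measurable_fun [set: d.-tuple R * R] (A \o fst) by exact: measurableT_comp.
have mB1 : measurable_fun [set: d.-tuple R * R] (B \o fst) by exact: measurableT_comp.
have mle := measurable_snd_le z; have mF := measurable_cond_cdf z.
have mle' : measurable_fun [set: d.-tuple R * R] (fun u => 1 - (u.2 <= z)%R%:R : R)%R.
  exact: measurable_funB.
have mF' : measurable_fun [set: d.-tuple R * R] (fun u => 1 - F u.1 z)%R.
  exact: measurable_funB.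
have le01 (u : d.-tuple R * R) : (0 <= ((u.2 <= z)%R%:R : R) <= 1)%R.
  by case: (u.2 <= z)%R; rewrite ?lexx ?ler01.
have F01 u : (0 <= F u z <= 1)%R by rewrite cumulative01_ge0 cumulative01_le1.
have mS (f : d.-tuple R -> R) t : measurable_fun [set: d.-tuple R] f ->
    measurable [set x | (0 <= t < f x)%R].
  move=> mf; rewrite -[X in measurable X]setTI.
  suff : measurable_fun [set: d.-tuple R] (fun x => (0 <= t < f x)%R).
    by move=> /(_ measurableT [set true]); apply.
  by apply: measurable_and => //; exact: measurable_fun_ltr.
under eq_integral do rewrite EFinD.
under [RHS]eq_integral do rewrite EFinD.
rewrite !ge0_integralD//; try by [apply/measurable_EFinP; exact: measurable_funM|
  move=> u _; rewrite lee_fin mulr_ge0// ?subr_ge0; case/andP: (le01 u)|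
  move=> u _; rewrite lee_fin mulr_ge0// ?subr_ge0; case/andP: (F01 u.1)].
rewrite !(@ge0_integral_layer_cake _ _ _ P (_ \o fst))//.
all: try by [move=> u /=; case/andP: (le01 u)|move=> u /=; case/andP: (F01 u.1)
  |move=> u /=; rewrite subr_ge0; case/andP: (le01 u)
  |move=> u /=; rewrite subr_ge0; case/andP: (F01 u.1)
  |move=> u /=; exact: A0 |move=> u /=; exact: B0].
congr (_ + _); apply: eq_integral => t _.
  transitivity (\int[P]_u (\1_[set x | (0 <= t < A x)%R] u.1 * (u.2 <= z)%R%:R)%:E).
    by apply: eq_integral => u _; rewrite indicE/= mem_setE.
  by rewrite cond_cdf_indic; [apply: eq_integral => u _; rewrite indicE/= mem_setE|exact: mS].
transitivity (\int[P]_u (\1_[set x | (0 <= t < B x)%R] u.1 * (1 - (u.2 <= z)%R%:R))%:E).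
  by apply: eq_integral => u _; rewrite indicE/= mem_setE.
by rewrite cond_cdf_indicC; [apply: eq_integral => u _; rewrite indicE/= mem_setE|exact: mS].
Qed.

End conditional.

Section risk.
Context {R : realType} {d : nat} (P : probability (d.-tuple R * R)%type R).
Implicit Types F G : d.-tuple R -> cumulativeBounded (0 : R)%R (1 : R)%R.

Definition sq_dist G F : \bar R :=
  \int[lebesgue_measure]_z \int[P]_u ((G u.1 z - F u.1 z) ^+ 2)%:E.

Lemma measurable_cumulative01_pair F :
  (forall z, measurable_fun [set: d.-tuple R] (fun x => F x z)) ->
  measurable_fun [set: (d.-tuple R * R) * R] (fun v => F v.1.1 v.2).
Proof.
move=> mF.
exact: (measurable_cumulative01_uncurry (F := F \o fst)
  (fun z => measurableT_comp (mF z) (@measurable_fst _ _ _ _))).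
Qed.

Lemma risk_sum G F : is_cond_cdf P F ->
  (forall z, measurable_fun [set: d.-tuple R] (fun x => G x z)) ->
  risk P G = \int[lebesgue_measure]_z \int[P]_u
    ((G u.1 z - F u.1 z) ^+ 2 + F u.1 z * (1 - F u.1 z))%:E.
Proof.
move=> PF mG; rewrite /risk /crps.
pose f (v : (d.-tuple R * R) * R) : \bar R :=
  ((G v.1.1 v.2 - (v.1.2 <= v.2)%R%:R) ^+ 2)%:E.
have mf : measurable_fun setT f.
  apply/measurable_EFinP; apply: measurable_funX; apply: measurable_funB.
    exact: measurable_cumulative01_pair.
  apply: (measurableT_comp (f := fun b : bool => b%:R : R)) => //.
  apply: measurable_fun_ler => //.
  by apply: (measurableT_comp (f := snd)).
rewrite (fubini_tonelli (m1 := P) (m2 := lebesgue_measure) f)//; last first.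
  by move=> v; rewrite lee_fin sqr_ge0.
apply: eq_integral => z _; rewrite /f/=.
transitivity (\int[P]_u ((1 - G u.1 z) ^+ 2 * (u.2 <= z)%R%:R
    + (G u.1 z) ^+ 2 * (1 - (u.2 <= z)%R%:R))%:E).
  apply: eq_integral => u _; congr EFin.
  by case: (u.2 <= z)%R => /=; ring.
rewrite (@cond_cdf_integral _ _ P F PF (fun x => (1 - G x z) ^+ 2)%R
   (fun x => (G x z) ^+ 2)%R z).
- by apply: eq_integral => u _; congr EFin; ring.
- by apply: measurable_funX; apply: measurable_funB => //; exact: mG.
- by apply: measurable_funX; exact: mG.
- by move=> x; exact: sqr_ge0.
- by move=> x; exact: sqr_ge0.
Qed.

Lemma measurable_sq_dist G F z :
  (forall z, measurable_fun [set: d.-tuple R] (fun x => G x z)) ->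
  (forall z, measurable_fun [set: d.-tuple R] (fun x => F x z)) ->
  measurable_fun [set: d.-tuple R * R] (fun u => ((G u.1 z - F u.1 z) ^+ 2)%R).
Proof.
by move=> mG mF; apply: measurable_funX; apply: measurable_funB;
  [apply: (measurableT_comp (mG z))|apply: (measurableT_comp (mF z))].
Qed.

Lemma riskE F : is_cond_cdf P F ->
  risk P F = \int[lebesgue_measure]_z \int[P]_u (F u.1 z * (1 - F u.1 z))%:E.
Proof.
move=> PF; rewrite (risk_sum PF); last exact: PF.1.
apply: eq_integral => z _; apply: eq_integral => u _.
by rewrite subrr expr0n add0r.
Qed.

Lemma risk_decomp G F : is_cond_cdf P F ->
  (forall z, measurable_fun [set: d.-tuple R] (fun x => G x z)) ->
  risk P G = risk P F + sq_dist G F.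
Proof.
move=> PF mG; rewrite (risk_sum PF mG) (riskE PF) addeC /sq_dist.
have F0 z u : (0 <= F u z * (1 - F u z))%R.
  by rewrite mulr_ge0 ?subr_ge0 ?cumulative01_ge0 ?cumulative01_le1.
have mF2 := measurable_cumulative01_pair PF.1.
have mG2 := measurable_cumulative01_pair mG.
have mz (f : (d.-tuple R * R) * R -> \bar R) : measurable_fun setT f ->
    (forall v, 0 <= f v) ->
    measurable_fun setT (fun z => \int[P]_u f (u, z)).
  by move=> mf f0; exact: (measurable_fun_fubini_tonelli_G (m1 := P) f).
rewrite -ge0_integralD//; last 4 first.
- by move=> z _; apply: integral_ge0 => u _; rewrite lee_fin sqr_ge0.
- apply: (mz (fun v => ((G v.1.1 v.2 - F v.1.1 v.2) ^+ 2)%:E)).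
    by apply/measurable_EFinP; apply: measurable_funX; exact: measurable_funB.
  by move=> v; rewrite lee_fin sqr_ge0.
- by move=> z _; apply: integral_ge0 => u _; rewrite lee_fin.
- apply: (mz (fun v => (F v.1.1 v.2 * (1 - F v.1.1 v.2))%:E)).
    apply/measurable_EFinP; apply: measurable_funM => //.
    exact: measurable_funB.
  by move=> v; rewrite lee_fin.
apply: eq_integral => z _; rewrite -ge0_integralD//.
- by move=> u _; rewrite lee_fin sqr_ge0.
- by apply/measurable_EFinP; apply: measurable_sq_dist => //; exact: PF.1.
- by move=> u _; rewrite lee_fin.
- apply/measurable_EFinP; have mFz := measurable_cond_cdf PF z.
  by apply: measurable_funM => //; exact: measurable_funB.
Qed.

(* Each of the two risks exceeds the other by a nonnegative quantity. *)
Lemma risk_cond_cdf_eq F G : is_cond_cdf P F -> is_cond_cdf P G ->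
  risk P F = risk P G.
Proof.
have le_risk F1 F2 : is_cond_cdf P F1 -> is_cond_cdf P F2 -> risk P F1 <= risk P F2.
  move=> P1 P2; rewrite (risk_decomp P1 (P2.1)) leeDl//.
  by do 2 (apply: integral_ge0 => ? _); rewrite lee_fin sqr_ge0.
by move=> PF PG; apply/eqP; rewrite eq_le !le_risk.
Qed.

Lemma measurable_predictor_sq_diff n (Fhat : n.-tuple (d.-tuple R * R) ->
    d.-tuple R -> cumulativeBounded (0 : R)%R (1 : R)%R) F :
  is_cond_cdf P F -> predictors Fhat ->
  measurable_fun setT (fun v : (n.-tuple (d.-tuple R * R) * (d.-tuple R * R)) * R =>
    ((Fhat v.1.1 v.1.2.1 v.2 - F v.1.2.1 v.2) ^+ 2)%:E).
Proof.
move=> PF mFhat.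
apply/measurable_EFinP; apply: measurable_funX; apply: measurable_funB.
  have H := @measurable_cumulative01_uncurry R _ _ (fun w => Fhat w.1 w.2) mFhat.
  refine (measurableT_comp (g :=
    fun v : (n.-tuple (d.-tuple R * R) * (d.-tuple R * R)) * R =>
      ((v.1.1, v.1.2.1), v.2)) H _).
  apply: measurable_fun_pair => //=; apply: measurable_fun_pair => /=.
    exact: (measurableT_comp (f := fst)).
  by apply: (measurableT_comp (f := fst)) => //; exact: (measurableT_comp (f := snd)).
have H := measurable_cumulative01_pair PF.1.
refine (measurableT_comp (g :=
  fun v : (n.-tuple (d.-tuple R * R) * (d.-tuple R * R)) * R => (v.1.2, v.2)) H _).
apply: measurable_fun_pair => //=.
exact: (measurableT_comp (f := snd)).
Qed.

Lemma expected_risk_decomp n (Fhat : n.-tuple (d.-tuple R * R) ->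
    d.-tuple R -> cumulativeBounded (0 : R)%R (1 : R)%R) F :
  is_cond_cdf P F -> predictors Fhat ->
  expected_risk P Fhat = risk P F +
    \int[lebesgue_measure]_z \int[sample_law P n]_D
      \int[P]_u ((Fhat D u.1 z - F u.1 z) ^+ 2)%:E.
Proof.
move=> PF mFhat; rewrite /expected_risk.
have mD D z : measurable_fun [set: d.-tuple R] (fun x => Fhat D x z).
  exact: (measurableT_comp (mFhat z) (pair1_measurable D)).
under eq_integral do rewrite (risk_decomp PF (mD _)).
pose f (v : (n.-tuple (d.-tuple R * R) * R) * (d.-tuple R * R)) : \bar R :=
  ((Fhat v.1.1 v.2.1 v.1.2 - F v.2.1 v.1.2) ^+ 2)%:E.
have f0 v : 0 <= f v by rewrite lee_fin sqr_ge0.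
have mf : measurable_fun setT f.
  apply: (measurableT_comp (g := fun v : (n.-tuple (d.-tuple R * R) * R) *
    (d.-tuple R * R) => ((v.1.1, v.2), v.1.2)) (measurable_predictor_sq_diff PF mFhat)).
  apply: measurable_fun_pair => /=; last exact: (measurableT_comp (f := snd)).
  by apply: measurable_fun_pair => //=; exact: (measurableT_comp (f := fst)).
pose k w := fubini_F P f w.
have mk : measurable_fun setT k by exact: measurable_fun_fubini_tonelli_F.
have k0 w : 0 <= k w by apply: integral_ge0.
rewrite ge0_integralD//.
- rewrite integral_cst_probability; congr (_ + _).
  exact: (fubini_tonelli (m1 := sample_law P n) (m2 := lebesgue_measure) k).
- by move=> D _; do 2 (apply: integral_ge0 => ? _); rewrite lee_fin sqr_ge0.
- by move=> D _; do 2 (apply: integral_ge0 => ? _); rewrite lee_fin sqr_ge0.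
- exact: (measurable_fun_fubini_tonelli_F (m2 := lebesgue_measure) k).
Qed.

End risk.

(** * Lower bound *)

Lemma sum_tuple_cons (V : nmodType) (I : finType) n (F : n.+1.-tuple I -> V) :
  (\sum_(t : n.+1.-tuple I) F t =
   \sum_(i : I) \sum_(t : n.-tuple I) F [tuple of i :: t])%R.
Proof.
rewrite pair_big/=.
rewrite (reindex (fun p : I * n.-tuple I => [tuple of p.1 :: p.2]))//=.
exists (fun t => (thead t, [tuple of behead t])) => [[i t] _|t _] /=.
  by congr (_, _); apply: val_inj.
by rewrite [RHS]tuple_eta.
Qed.

Section atomic.
Context {R : realType} {I : finType} dT {T : measurableType dT}.
Variables (w : I -> R) (a : I -> T).
Hypotheses (w0 : forall i, (0 <= w i)%R) (w1 : (\sum_i w i = 1)%R).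

Let atom_measure (i : I) : {measure set T -> \bar R} :=
  mscale (NngNum (w0 i)) (dirac (a i)).

(* [msum] is indexed by [nat], hence the detour through ordinals; the mention
   of [w1] makes the probability structure declared below inferable. *)
Definition atomic_law : set T -> \bar R := let _ := w1 in
  msum (fun k => if insub k is Some j then atom_measure (enum_val (j : 'I_#|I|))
                 else mzero) #|I|.

HB.instance Definition _ := Measure.on atomic_law.

Let integral_msum (f : T -> \bar R) : measurable_fun [set: T] f ->
  (forall x, 0 <= f x) -> \int[atomic_law]_x f x = \sum_i (w i)%:E * f (a i).
Proof.
move=> mf f0; rewrite ge0_integral_measure_sum//= (reindex (@enum_val I I))/=; last first.
  by apply: onW_bij; exact: enum_val_bij.
apply: eq_bigr => j _; rewrite valK.
by rewrite ge0_integral_mscale//= integral_dirac// diracT mul1e.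
Qed.

Let atomic_law_setT : atomic_law [set: T] = 1.
Proof.
rewrite -[LHS]mul1e -integral_cst// integral_msum//.
under eq_bigr do rewrite mule1.
by rewrite sumEFin w1.
Qed.

HB.instance Definition _ :=
  @Measure_isProbability.Build _ _ _ atomic_law atomic_law_setT.

Lemma ge0_integral_atomic_law (f : T -> \bar R) : measurable_fun [set: T] f ->
  (forall x, 0 <= f x) -> \int[atomic_law]_x f x = \sum_i (w i)%:E * f (a i).
Proof. exact: integral_msum. Qed.

Lemma ge0_integral_sample_atomic_law n (f : n.-tuple T -> \bar R) :
  measurable_fun [set: n.-tuple T] f -> (forall t, 0 <= f t) ->
  \int[sample_law atomic_law n]_t f t =
  \sum_(t : n.-tuple I) (\prod_(i <- t) w i)%:E * f [tuple of map a t].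
Proof.
elim: n f => [|n IHn] f mf f0.
  rewrite ge0_integral_sample_law0// (big_pred1 [tuple]); last first.
    by move=> t; apply/esym/eqP; exact: tuple0.
  by rewrite big_nil mul1e; congr (f _); exact: val_inj.
have mcons x : measurable_fun setT (fun t : n.-tuple T => f [tuple of x :: t]).
  have := measurableT_comp mf (@measurable_cons_tuple _ T n).
  by move=> /(measurableT_comp)/(_ (pair1_measurable x)).
rewrite ge0_integral_sample_law_cons// ge0_integral_atomic_law//; last 2 first.
- apply: (measurable_fun_fubini_tonelli_F (m2 := sample_law atomic_law n)
    (fun u => f [tuple of u.1 :: u.2])) => //.
  exact: (measurableT_comp mf (@measurable_cons_tuple _ T n)).
- by move=> x; apply: integral_ge0.
rewrite sum_tuple_cons; apply: eq_bigr => i _; rewrite IHn//.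
rewrite ge0_sume_distrr; last first.
  by move=> t _; rewrite mule_ge0// lee_fin; apply: prodr_ge0.
apply: eq_bigr => t _; rewrite muleA -EFinM big_cons; congr (_ * f _).
exact: val_inj.
Qed.

End atomic.

Section hypercube.
Context {R : realType}.
Local Open Scope ring_scope.

Lemma sum_tuple_prod (I : finType) n (g : I -> R) :
  \sum_(t : n.-tuple I) \prod_(i <- t) g i = (\sum_i g i) ^+ n.
Proof.
elim: n => [|n IHn].
  rewrite (big_pred1 [tuple]); last by move=> t; apply/esym/eqP; exact: tuple0.
  by rewrite big_nil.
rewrite sum_tuple_cons exprS mulr_suml; apply: eq_bigr => i _.
by rewrite -IHn mulr_sumr; apply: eq_bigr => t _; rewrite big_cons.
Qed.

Lemma expr1D_le2 (x : R) n : 0 <= x -> n%:R * x <= 2^-1 -> (1 + x) ^+ n <= 2.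
Proof.
move=> x0 nx.
suff : forall m, (m <= n)%N -> (1 + x) ^+ m * (1 - m%:R * x) <= 1.
  move=> /(_ n (leqnn n)) H; have := exprn_ge0 n (addr_ge0 ler01 x0); nra.
elim=> [_|m IHm mn]; first by rewrite expr0 mul0r subr0 mulr1.
apply: le_trans (IHm (ltnW mn)).
rewrite exprS -mulrA mulrCA ler_wpM2l ?exprn_ge0 ?addr_ge0//.
rewrite -natr1; have := ler0n R m; nra.
Qed.

(* With [r = q / p], completing the square in [u] leaves [d^2 r / (1 + r)],
   which lies above [d^2 r (5 - r) / 9], its tangent parabola at [r = 2]. *)
Lemma two_point_ineq (p q u s d : R) : 0 < p -> 0 <= q ->
  d ^+ 2 * (5 / 9 * q - 9^-1 * (q ^+ 2 / p)) <=
  p * (u - s) ^+ 2 + q * (u - (s + d)) ^+ 2.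
Proof.
move=> p0 q0; set v := u - s.
have -> : u - (s + d) = v - d by rewrite /v; ring.
have pq : 0 < p + q by lra.
rewrite -subr_ge0.
have -> : p * v ^+ 2 + q * (v - d) ^+ 2 - d ^+ 2 * (5 / 9 * q - 9^-1 * (q ^+ 2 / p)) =
  ((p + q) * v - q * d) ^+ 2 / (p + q)
  + d ^+ 2 * q * (q - 2 * p) ^+ 2 / (9 * p * (p + q)).
  by field; rewrite !lt0r_neq0.
apply: addr_ge0; apply: divr_ge0; first exact: sqr_ge0.
- exact: ltW.
- by rewrite mulr_ge0 ?sqr_ge0// mulr_ge0 ?sqr_ge0.
- by rewrite ltW// !mulr_gt0.
Qed.

Context {J : finType} (delta : R).
Hypotheses (J0 : (0 < #|J|)%N) (delta0 : 0 <= delta) (delta1 : delta <= 4^-1).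
Implicit Types (s : {ffun J -> bool}) (i : J * bool).

Definition vertex_prob s (j : J) : R := 2^-1 + (s j)%:R * delta.

Definition vertex_weight s i : R :=
  #|J|%:R^-1 * (if i.2 then 1 - vertex_prob s i.1 else vertex_prob s i.1).

Let K0 : 0 < #|J|%:R :> R. Proof. by rewrite ltr0n. Qed.

Lemma vertex_prob_gt0 s j : 0 < vertex_prob s j.
Proof.
rewrite /vertex_prob; case: (s j); rewrite ?mul1r ?mul0r;
  by have := delta0; have := delta1; lra.
Qed.

Lemma vertex_prob_lt1 s j : vertex_prob s j < 1.
Proof.
rewrite /vertex_prob; case: (s j); rewrite ?mul1r ?mul0r;
  by have := delta0; have := delta1; lra.
Qed.

Lemma vertex_weight_gt0 s i : 0 < vertex_weight s i.
Proof.
rewrite /vertex_weight mulr_gt0 ?invr_gt0//.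
by case: i.2; rewrite ?subr_gt0 ?vertex_prob_lt1 ?vertex_prob_gt0.
Qed.

Lemma sum_pair_bool (f : J * bool -> R) :
  \sum_i f i = \sum_j (f (j, true) + f (j, false)).
Proof.
rewrite (eq_bigr (fun i => f (i.1, i.2))); last by case.
rewrite -(pair_bigA _ (fun j b => f (j, b)))/=.
by apply: eq_bigr => j _; rewrite big_bool.
Qed.

Lemma sum_vertex_weight s : \sum_i vertex_weight s i = 1.
Proof.
rewrite sum_pair_bool (eq_bigr (fun=> #|J|%:R^-1)).
  by rewrite sumr_const -[LHS]mulr_natr mulVf// lt0r_neq0.
by move=> j _; rewrite /vertex_weight/= -mulrDr subrK mulr1.
Qed.

Definition flip (j : J) s : {ffun J -> bool} :=
  [ffun k => if k == j then ~~ s k else s k].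

Lemma flipK j : involutive (flip j).
Proof.
by move=> s; apply/ffunP => k; rewrite !ffunE; case: (k == j); rewrite ?negbK.
Qed.

Lemma sum_vertex_weight_chi2 s j : s j = false ->
  \sum_i vertex_weight (flip j s) i ^+ 2 / vertex_weight s i =
  1 + 4 * delta ^+ 2 / #|J|%:R.
Proof.
move=> sj; rewrite sum_pair_bool (bigD1 j)//=.
rewrite (eq_bigr (fun=> #|J|%:R^-1)); last first.
  move=> k kj; rewrite /vertex_weight/vertex_prob/= ffunE (negbTE kj).
  have := vertex_prob_gt0 s k; have := vertex_prob_lt1 s k; rewrite /vertex_prob.
  set p := 2^-1 + _ => p1 p0; field.
  by rewrite lt0r_neq0//= (lt0r_neq0 p0) subr_eq0 gt_eqF.
rewrite sumr_const cardC1 -[_ *+ _]mulr_natr -subn1 natrB//.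
rewrite /vertex_weight/vertex_prob/= ffunE eqxx sj/=.
by field; rewrite lt0r_neq0//; lra.
Qed.

Lemma two_vertex_bound n (u : n.-tuple (J * bool) -> R) s j : s j = false ->
  n%:R * (4 * delta ^+ 2 / #|J|%:R) <= 2^-1 ->
  delta ^+ 2 / 3 <=
  \sum_(t : n.-tuple _) (\prod_(i <- t) vertex_weight s i) * (u t - vertex_prob s j) ^+ 2 +
  \sum_(t : n.-tuple _) (\prod_(i <- t) vertex_weight (flip j s) i) *
    (u t - vertex_prob (flip j s) j) ^+ 2.
Proof.
move=> sj nd; rewrite -big_split/=.
pose W s (t : n.-tuple (J * bool)) := \prod_(i <- t) vertex_weight s i.
have W0 s' t : 0 < W s' t by apply: prodr_gt0 => i _; exact: vertex_weight_gt0.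
apply: (@le_trans _ _ (\sum_(t : n.-tuple (J * bool))
    delta ^+ 2 * (5 / 9 * W (flip j s) t - 9^-1 * (W (flip j s) t ^+ 2 / W s t)))); last first.
  apply: ler_sum => t _.
  have -> : vertex_prob (flip j s) j = vertex_prob s j + delta.
    by rewrite /vertex_prob ffunE eqxx sj/= mul0r mul1r addr0.
  by apply: two_point_ineq => //; exact: ltW.
rewrite -mulr_sumr sumrB -!mulr_sumr.
have -> : \sum_(t : n.-tuple (J * bool)) W (flip j s) t = 1.
  by rewrite sum_tuple_prod sum_vertex_weight expr1n.
have -> : \sum_(t : n.-tuple (J * bool)) W (flip j s) t ^+ 2 / W s t =
    (1 + 4 * delta ^+ 2 / #|J|%:R) ^+ n.
  rewrite -(sum_vertex_weight_chi2 sj) -sum_tuple_prod; apply: eq_bigr => t _.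
  by rewrite /W -prodrXl -prodfV -big_split.
have x0 : 0 <= 4 * delta ^+ 2 / #|J|%:R.
  by apply: divr_ge0; rewrite ?ler0n// mulr_ge0 ?sqr_ge0.
have := expr1D_le2 x0 nd; have := sqr_ge0 delta; nra.
Qed.

Lemma hypercube_bound n (u : J -> n.-tuple (J * bool) -> R) :
  n%:R * (4 * delta ^+ 2 / #|J|%:R) <= 2^-1 ->
  \sum_(s : {ffun J -> bool}) delta ^+ 2 / 6 <=
  \sum_(s : {ffun J -> bool}) \sum_(t : n.-tuple (J * bool))
    (\prod_(i <- t) vertex_weight s i) *
    \sum_(i : J * bool) vertex_weight s i * (u i.1 t - vertex_prob s i.1) ^+ 2.
Proof.
move=> nd.
pose A j s := \sum_(t : n.-tuple _) (\prod_(i <- t) vertex_weight s i) *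
  (u j t - vertex_prob s j) ^+ 2.
rewrite [leRHS](_ : _ = \sum_(j : J) #|J|%:R^-1 * \sum_s A j s); last first.
  under [RHS]eq_bigr do rewrite mulr_sumr.
  rewrite [RHS]exchange_big/=; apply: eq_bigr => s _.
  under [RHS]eq_bigr do rewrite mulr_sumr.
  rewrite [RHS]exchange_big/=; apply: eq_bigr => t _.
  rewrite sum_pair_bool mulr_sumr; apply: eq_bigr => j _.
  by rewrite /vertex_weight/=; ring.
have AE j : \sum_s A j s = 2^-1 * \sum_s (A j s + A j (flip j s)).
  rewrite big_split/=.
  have -> : \sum_s A j (flip j s) = \sum_s A j s.
    by rewrite [RHS](reindex_inj (inv_inj (@flipK j))).
  by field.
have pairA j s : delta ^+ 2 / 3 <= A j s + A j (flip j s).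
  case sj : (s j); last exact: two_vertex_bound.
  rewrite addrC -{2}[s](flipK j); apply: two_vertex_bound => //.
  by rewrite ffunE eqxx sj.
apply: (@le_trans _ _ (\sum_(j : J) #|J|%:R^-1 * (2^-1 *
    \sum_(s : {ffun J -> bool}) (delta ^+ 2 / 3)))); last first.
  apply: ler_sum => j _; rewrite AE ler_pM2l ?invr_gt0// ler_pM2l ?invr_gt0//.
  by apply: ler_sum => s _; exact: pairA.
rewrite [leRHS]sumr_const -[leRHS]mulr_natr [leRHS]mulrC mulVKf ?lt0r_neq0//.
by rewrite mulr_sumr ler_sum// => s _; lra.
Qed.

End hypercube.

Section mixture.
Context {R : realType} {I : finType} (w y : I -> R).
Hypotheses (w0 : forall i, (0 <= w i)%R) (w1 : (\sum_i w i = 1)%R).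

Let f (z : R) : R := (\sum_i w i * (y i <= z)%R%:R)%R.

Lemma mixture_cdf : { F : cumulativeBounded (0 : R)%R (1 : R)%R |
  forall z, F z = (\sum_i w i * (y i <= z)%R%:R)%R }.
Proof.
have cvgf (G : set_system R) (FG : Filter G) (b : I -> bool) :
    (forall i, \forall t \near G, (y i <= t)%R = b i) ->
    f @ G --> (\sum_i w i * (b i)%:R)%R.
  move=> yb; apply: cvg_near_cst.
  have := filter_forall FG yb; apply: filterS => t yt.
  by apply: eq_bigr => i _; rewrite yt.
have nd : nondecreasing f.
  move=> s t st; apply: ler_sum => i _; apply: ler_wpM2l => //.
  by rewrite ler_nat; case: (leP (y i) s) => // /le_trans ->.
have rc : right_continuous f.
  move=> x; apply: cvgf => i; case: leP => yx.
    by near=> t; apply: le_trans yx _; near: t; exact: nbhs_right_ge.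
  by near=> t; apply/negbTE; rewrite -ltNge; near: t; exact: nbhs_right_lt.
have fNy : f @ -oo%R --> (0 : R)%R.
  have -> : (0 = \sum_i w i * false%:R :> R)%R by rewrite big1// => i _; rewrite mulr0.
  apply: cvgf => i; near=> t; apply/negbTE; rewrite -ltNge; near: t.
  exact: (nbhs_ninfty_lt (num_real _)).
have fy : f @ +oo%R --> (1 : R)%R.
  have -> : (1 = \sum_i w i * true%:R :> R)%R.
    by under eq_bigr do rewrite mulr1; rewrite w1.
  by apply: cvgf => i; near=> t; near: t; exact: (nbhs_pinfty_ge (num_real _)).
pose c1 := isCumulative.Build R _ R f nd rc.
pose c2 := isCumulativeBounded.Build R 0%R 1%R f fNy fy.
by exists (HB.pack_for (cumulativeBounded (0 : R)%R (1 : R)%R) f c1 c2).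
Unshelve. all: by end_near. Qed.

End mixture.

Section sup_dist.
Context {R : realType}.
Local Open Scope ring_scope.

Lemma powR_subadditive (h s t : R) : 0 < h <= 1 -> 0 <= s -> 0 <= t ->
  (s + t) `^ h <= s `^ h + t `^ h.
Proof.
move=> /andP[h0 h1] s0 t0.
have half (a b : R) : 0 <= a -> 0 <= b -> a * (a + b) `^ (h - 1) <= a `^ h.
  rewrite le_eqVlt => /predU1P[<-|a0] b0; first by rewrite mul0r powR_ge0.
  rewrite -(mulr_powRB1 (ltW a0) h0); apply: ler_wpM2l; first exact: ltW.
  rewrite -[h - 1]opprB !powRN lef_pV2 ?posrE ?powR_gt0//; last by lra.
  by rewrite ge0_ler_powR ?nnegrE; lra.
rewrite -(mulr_powRB1 (addr_ge0 s0 t0) h0) mulrDl.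
by apply: lerD; [exact: half|rewrite addrC; exact: half].
Qed.

Lemma measurable_bigmaxr d (T : measurableType d) (I : Type) (r : seq I)
    (P : pred I) (f : I -> T -> R) :
  (forall i, measurable_fun [set: T] (f i)) ->
  measurable_fun [set: T] (fun x => \big[Num.max/0]_(i <- r | P i) f i x).
Proof.
move=> mf; elim: r => [|i r IHr].
  by under eq_fun do rewrite big_nil; exact: measurable_cst.
under eq_fun do rewrite big_cons; case: (P i) => //.
exact: measurable_maxr.
Qed.

Context {d : nat}.
Implicit Types x y a : d.-tuple R.

Definition sup_dist x y : R := \big[Num.max/0]_(i < d) `|tnth x i - tnth y i|.

Lemma sup_dist_ge0 x y : 0 <= sup_dist x y.
Proof. exact: bigmax_ge_id. Qed.

Lemma sup_dist_triangle a x y : sup_dist x y <= sup_dist x a + sup_dist a y.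
Proof.
apply: bigmax_le => [|i _]; first by rewrite addr_ge0 ?sup_dist_ge0.
apply: le_trans (ler_distD (tnth a i) _ _) _.
by apply: lerD; exact: (le_bigmax _ (fun i => `|tnth _ i - tnth _ i|)).
Qed.

Lemma sup_distC x y : sup_dist x y = sup_dist y x.
Proof. by apply: eq_bigr => i _; rewrite distrC. Qed.

Lemma sup_distxx x : sup_dist x x = 0.
Proof. by apply: bigmax_eq_id => i _; rewrite subrr normr0. Qed.

Lemma sup_dist_le_enorm x y : sup_dist x y <= enorm (tsub x y).
Proof.
apply: bigmax_le => [|i _]; first exact: sqrtr_ge0.
rewrite -sqrtr_sqr ler_wsqrtr// (bigD1 i)//= tnth_mktuple lerDl.
by apply: sumr_ge0 => k _; exact: sqr_ge0.
Qed.

Lemma enorm_le x y (c : R) : 0 <= c ->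
  (forall i, `|tnth x i - tnth y i| <= c) -> enorm (tsub x y) <= Num.sqrt d%:R * c.
Proof.
move=> c0 xyc.
rewrite -[X in _ * X](ger0_norm c0) -sqrtr_sqr -sqrtrM ?ler0n// ler_wsqrtr//.
rewrite mulr_natl -[X in _ *+ X]card_ord -sumr_const.
apply: ler_sum => i _; rewrite tnth_mktuple -[leLHS]real_normK ?num_real//.
by rewrite lerXn2r ?nnegrE.
Qed.

Lemma measurable_sup_dist a : measurable_fun [set: d.-tuple R] (sup_dist ^~ a).
Proof.
apply: measurable_bigmaxr => i; apply: measurableT_comp => //.
by apply: measurable_funB => //; exact: measurable_tnth.
Qed.

Context {J : finType} (p : J -> d.-tuple R) (h L delta : R).
Hypotheses (h01 : 0 < h <= 1) (L0 : 0 <= L) (delta0 : 0 <= delta).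
Implicit Types s : {ffun J -> bool}.

(* McShane-type extension of the values [(s j) * delta] at the points [p j]. *)
Definition spike s x : R :=
  \big[Num.max/0]_(j | s j) (delta - L * sup_dist x (p j) `^ h).

Lemma spike_ge0 s x : 0 <= spike s x.
Proof. exact: bigmax_ge_id. Qed.

Lemma spike_le s x : spike s x <= delta.
Proof.
apply: bigmax_le => // j _; rewrite gerBl.
by rewrite mulr_ge0 ?powR_ge0.
Qed.

Lemma spike_holder s x y : `|spike s x - spike s y| <= L * sup_dist x y `^ h.
Proof.
have le1 x' y' : spike s x' <= spike s y' + L * sup_dist x' y' `^ h.
  have D0 : 0 <= L * sup_dist x' y' `^ h by rewrite mulr_ge0 ?powR_ge0.
  apply: bigmax_le => [|j sj]; first by rewrite addr_ge0 ?spike_ge0.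
  apply: (@le_trans _ _ (delta - L * sup_dist y' (p j) `^ h + L * sup_dist x' y' `^ h)).
    rewrite -addrA lerD2l lerNl opprD opprK lerBlDr -mulrDr ler_wpM2l//.
    apply: le_trans (powR_subadditive h01 (sup_dist_ge0 _ _) (sup_dist_ge0 _ _)).
    rewrite ge0_ler_powR ?nnegrE ?addr_ge0 ?sup_dist_ge0//; first by case/andP: h01 => /ltW.
    by rewrite addrC [X in X + _]sup_distC; exact: sup_dist_triangle.
  by rewrite lerD2r; exact: (le_bigmax_cond _ (fun j => delta - L * sup_dist y' (p j) `^ h)).
rewrite ler_norml [X in _ && X]lerBlDl le1 andbT lerNl opprB lerBlDl sup_distC.
exact: le1.
Qed.

Lemma measurable_spike s : measurable_fun [set: d.-tuple R] (spike s).
Proof.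
apply: measurable_bigmaxr => j; apply: measurable_funB => //.
apply: measurable_funM => //.
apply: (measurableT_comp (f := (@powR R)^~ h)); first exact: measurable_powR.
exact: measurable_sup_dist.
Qed.

Lemma spike_node s j : (forall k, k != j -> delta <= L * sup_dist (p j) (p k) `^ h) ->
  spike s (p j) = (s j)%:R * delta.
Proof.
move=> sep; have h0 : h != 0 by case/andP: h01 => /lt0r_neq0.
apply/eqP; rewrite eq_le; apply/andP; split.
  apply: bigmax_le => [|k sk]; first by rewrite mulr_ge0.
  have [kj|kj] := eqVneq k j.
    by rewrite -kj sk mul1r sup_distxx powR0// mulr0 subr0.
  by rewrite (@le_trans _ _ 0)// ?mulr_ge0// subr_le0 sep.
case sj : (s j); last by rewrite mul0r spike_ge0.
rewrite mul1r.
apply: le_trans (le_bigmax_cond _ (fun k => delta - L * sup_dist (p j) (p k) `^ h) sj).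
by rewrite sup_distxx powR0// mulr0 subr0.
Qed.

End sup_dist.

Section misc.
Context {R : realType}.

Lemma Lnorm2_le (f : R -> R) (c : R) : (0 <= c)%R ->
  ('N[lebesgue_measure]_2%:E[EFin \o f] <= c%:E) =
  (\int[lebesgue_measure]_z ((f z) ^+ 2)%:E <= (c ^+ 2)%:E).
Proof.
move=> c0.
have -> : \int[lebesgue_measure]_z ((f z) ^+ 2)%:E =
    'N[lebesgue_measure]_2%:E[EFin \o f] `^ 2.
  rewrite poweR_Lnorm//; apply: eq_integral => z _ /=.
  by rewrite powR_mulrn// real_normK// num_real.
have := Lnorm_ge0 (@lebesgue_measure R) 2%:E (EFin \o f).
case: ('N[_]__[_]) => [r r0|_|//].
  by rewrite poweR_EFin powR_mulrn// !lee_fin ler_sqr ?nnegrE.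
by rewrite poweRyr//.
Qed.

Context {d : nat}.

Lemma risk_le (P : probability (d.-tuple R * R)%type R) F (M : R) :
  is_cond_cdf P F ->
  (forall x, \int[lebesgue_measure]_z (F x z * (1 - F x z))%:E <= M%:E) ->
  risk P F <= M%:E.
Proof.
move=> PF FM; rewrite (riskE PF).
have mF2 := measurable_cumulative01_pair PF.1.
have mf : measurable_fun setT (fun v : (d.-tuple R * R) * R =>
    (F v.1.1 v.2 * (1 - F v.1.1 v.2))%:E).
  by apply/measurable_EFinP; apply: measurable_funM => //; exact: measurable_funB.
have f0 (v : (d.-tuple R * R) * R) : 0 <= (F v.1.1 v.2 * (1 - F v.1.1 v.2))%:E.
  by rewrite lee_fin mulr_ge0 ?subr_ge0 ?cumulative01_ge0 ?cumulative01_le1.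
rewrite -(fubini_tonelli (m1 := P) (m2 := lebesgue_measure) _ mf f0)/=.
rewrite -[leRHS](integral_cst_probability P); apply: ge0_le_integral => //.
- by move=> u _; apply: integral_ge0 => z _; exact: (f0 (u, z)).
- exact: (measurable_fun_fubini_tonelli_F (m2 := lebesgue_measure) _ mf f0).
Qed.

End misc.

Section lower_family.
Context {R : realType} {d m : nat} (h L M : R).
Hypotheses (m0 : (0 < m)%N) (h01 : (0 < h <= 1)%R).
Hypotheses (L0 : (0 <= L)%R) (L1 : (L <= 4^-1)%R) (M0 : (0 < M)%R).

Local Notation J := {ffun 'I_d -> 'I_m}.
Implicit Types s : {ffun J -> bool}.

Definition node (j : J) : d.-tuple R := [tuple ((j i)%:R / m%:R)%R | i < d].

Definition cell_gap : R := (L * m%:R `^ (- h))%R.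

Let mR : (0 < m%:R :> R)%R. Proof. by rewrite ltr0n. Qed.

Lemma card_node : #|J| = (m ^ d)%N.
Proof. by rewrite card_ffun !card_ord. Qed.

Lemma card_node_gt0 : (0 < #|J|)%N.
Proof. by rewrite card_node expn_gt0 m0. Qed.

Lemma node_cube j : unit_cube (node j).
Proof.
move=> i; rewrite tnth_mktuple divr_ge0//= ler_pdivrMr// mul1r ler_nat.
exact: ltnW.
Qed.

Lemma cell_gap_ge0 : (0 <= cell_gap)%R.
Proof. by rewrite mulr_ge0 ?powR_ge0. Qed.

Lemma cell_gap_le : (cell_gap <= 4^-1)%R.
Proof.
apply: le_trans L1; rewrite ler_piMr// powRN invf_le1 ?powR_gt0//.
rewrite -[leLHS](powRr0 m%:R) ler_powR ?ler1n//.
by case/andP: h01 => /ltW.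
Qed.

Lemma node_sep j k : k != j -> (cell_gap <= L * sup_dist (node j) (node k) `^ h)%R.
Proof.
move=> kj; rewrite ler_wpM2l//.
have -> : (m%:R `^ (- h) = m%:R^-1 `^ h :> R)%R.
  by rewrite -powR_inv1 ?ler0n// -powRrM mulN1r.
rewrite ge0_ler_powR ?nnegrE ?sup_dist_ge0//; first by case/andP: h01 => /ltW.
have [i ki] : exists i, k i != j i.
  apply/existsP; apply: contraNT kj; rewrite negb_exists => /forallP H.
  by apply/eqP/ffunP => i; apply/eqP; move: (H i); rewrite negbK.
apply: (@le_trans _ _ `|tnth (node j) i - tnth (node k) i|%R); last first.
  exact: (le_bigmax _ (fun i => `|tnth (node j) i - tnth (node k) i|%R)).
rewrite !tnth_mktuple -mulrBl normrM [X in (_ <= _ * X)%R]gtr0_norm ?invr_gt0//.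
rewrite ler_peMl ?invr_ge0//.
have lt_dist (a b : nat) : (a < b)%N -> (1 <= `|b%:R - a%:R| :> R)%R.
  move=> ab; rewrite ger0_norm ?subr_ge0 ?ler_nat 1?ltnW//.
  by rewrite lerBrDr addrC natr1 ler_nat.
case: (ltngtP (j i) (k i)) ki => [ji_lt|ji_gt|/val_inj ->].
- by rewrite distrC => _; exact: lt_dist.
- by move=> _; exact: lt_dist.
- by rewrite eqxx.
Qed.

Let q s x := spike node h L cell_gap s x.

Let q01 s x : (0 <= q s x <= 4^-1)%R.
Proof.
by rewrite spike_ge0/= (le_trans _ cell_gap_le)// spike_le// cell_gap_ge0.
Qed.

Let two_weight s x (b : bool) : R := if b then (2^-1 - q s x)%R else (2^-1 + q s x)%R.
Let two_point (b : bool) : R := if b then M else 0%R.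

Let two_weight_ge0 s x b : (0 <= two_weight s x b)%R.
Proof. by have /andP[? ?] := q01 s x; case: b => /=; lra. Qed.

Let two_weight_sum s x : (\sum_b two_weight s x b = 1)%R.
Proof. by rewrite big_bool /=; lra. Qed.

Definition spike_cdf s x : cumulativeBounded (0 : R)%R (1 : R)%R :=
  sval (mixture_cdf two_point (two_weight_ge0 s x) (two_weight_sum s x)).

Lemma spike_cdfE s x z : spike_cdf s x z =
  ((2^-1 - q s x) * (M <= z)%R%:R + (2^-1 + q s x) * (0 <= z)%R%:R)%R.
Proof.
by rewrite /spike_cdf; case: mixture_cdf => F /= ->; rewrite big_bool.
Qed.

Definition node_atom (i : J * bool) : d.-tuple R * R := (node i.1, two_point i.2).

Definition node_law s : probability (d.-tuple R * R)%type R :=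
  atomic_law node_atom
   (fun i => ltW (vertex_weight_gt0 card_node_gt0 cell_gap_ge0 cell_gap_le s i))
   (sum_vertex_weight cell_gap card_node_gt0 s).


Lemma ge0_integral_node_law s (f : d.-tuple R * R -> \bar R) :
  measurable_fun [set: d.-tuple R * R] f -> (forall x, 0 <= f x) ->
  \int[node_law s]_u f u =
  \sum_i (vertex_weight cell_gap s i)%:E * f (node_atom i).
Proof. by move=> mf f0; rewrite ge0_integral_atomic_law. Qed.

Lemma spike_at_node s j : q s (node j) = ((s j)%:R * cell_gap)%R.
Proof.
by rewrite /q spike_node// ?cell_gap_ge0// => k kj; exact: node_sep.
Qed.

Lemma measurable_spike_cdf s z :
  measurable_fun [set: d.-tuple R] (fun x => spike_cdf s x z).
Proof.
under eq_fun do rewrite spike_cdfE.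
have mq : measurable_fun [set: d.-tuple R] (q s) by exact: measurable_spike.
by apply: measurable_funD; apply: measurable_funM => //;
  [exact: measurable_funB|exact: measurable_funD].
Qed.

Lemma spike_cdf_cond s : is_cond_cdf (node_law s) (spike_cdf s).
Proof.
split=> [z|A y mA]; first exact: measurable_spike_cdf.
have mAy : measurable (A `*` `]-oo, y]%classic) by exact: measurableX.
transitivity (\int[node_law s]_u (\1_(A `*` `]-oo, y]) u)%:E).
  by rewrite integral_indic// setIT.
rewrite [RHS]integral_mkcond/=; set g := (_ \_ A).
have mg : measurable_fun [set: d.-tuple R] g.
  apply/(measurable_restrictT (EFin \o (fun x => spike_cdf s x y))) => //.
  by apply/measurable_EFinP; apply: measurable_funTS; exact: measurable_spike_cdf.
have g0 x : 0 <= g x.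
  rewrite /g patchE; case: ifPn => // _; rewrite lee_fin.
  exact: cumulative01_ge0.
rewrite ge0_integral_distribution//.
rewrite !ge0_integral_node_law//; last 3 first.
- by apply/measurable_EFinP; exact: measurable_indic.
- exact: measurableT_comp.
- by move=> u; exact: g0.
pose chi i : R := (\1_A (node i.1) * (two_point i.2 <= y)%R%:R)%R.
rewrite (eq_bigr (fun i => (vertex_weight cell_gap s i * chi i)%:E)); last first.
  move=> i _; rewrite EFinM; congr (_ * _%:E).
  rewrite /chi !indicE/= -natrM mulnb; congr (nat_of_bool _)%:R.
  apply/idP/andP; rewrite !inE/= in_itv/=; first by move=> [].
  by move=> [].
rewrite [RHS](eq_bigr (fun i : J * bool => (vertex_weight cell_gap s i *
    (\1_A (node i.1) * spike_cdf s (node i.1) y))%:E)); last first.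
  move=> i _; rewrite /g/= patchE indicE.
  by case: (node i.1 \in A); rewrite ?mul1r// mul0r mulr0 mule0.
rewrite !sumEFin; congr EFin; rewrite !sum_pair_bool; apply: eq_bigr => j _.
rewrite spike_cdfE spike_at_node /vertex_weight /chi/= /vertex_prob.
by field; rewrite pnatr_eq0 -lt0n card_node_gt0.
Qed.

Lemma spike_cdf_dispersion s x :
  \int[lebesgue_measure]_z (spike_cdf s x z * (1 - spike_cdf s x z))%:E <= M%:E.
Proof.
apply: (@le_trans _ _ (\int[lebesgue_measure]_z (\1_`[0%R, M[ z)%:E)).
  apply: ge0_le_integral => //.
  - by move=> z _; rewrite lee_fin mulr_ge0 ?subr_ge0 ?cumulative01_ge0 ?cumulative01_le1.
  - have mF : measurable_fun [set: R] (spike_cdf s x).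
      apply: nondecreasing_measurable => //.
      exact: cumulative_is_nondecreasing.
    apply/measurable_EFinP; apply: measurable_funM => //.
    exact: measurable_funB.
  - by apply/measurable_EFinP; exact: measurable_indic.
  move=> z _; rewrite lee_fin indicE mem_setE in_itv/= spike_cdfE.
  have := q01 s x => /andP[q0 q1].
  case: (leP 0%R z) => z0; case: (ltP z M) => zM /=; rewrite ?mulr1 ?mulr0; try nra.
  by have := M0; lra.
by rewrite integral_indic_itv0// ltW.
Qed.

Lemma spike_cdf_L2 s x x' :
  \int[lebesgue_measure]_z ((spike_cdf s x' z - spike_cdf s x z) ^+ 2)%:E =
  ((q s x' - q s x) ^+ 2 * M)%:E.
Proof.
transitivity (\int[lebesgue_measure]_z
    (((q s x' - q s x) ^+ 2)%:E * (\1_`[0%R, M[ z)%:E)); last first.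
  rewrite ge0_integralZl_EFin//; last 2 first.
  - by apply/measurable_EFinP; exact: measurable_indic.
  - exact: sqr_ge0.
  by rewrite integral_indic_itv0 ?ltW// -EFinM.
apply: eq_integral => z _; rewrite -EFinM indicE mem_setE in_itv/= !spike_cdfE.
have := M0; case: (leP 0%R z) => z0; case: (ltP z M) => zM /=;
  rewrite ?mulr1 ?mulr0; try by move=> _; congr EFin; ring.
by move=> ?; exfalso; lra.
Qed.

Lemma measurable_unit_cube : measurable (@unit_cube R d).
Proof.
rewrite (_ : @unit_cube R d = \bigcap_(i in [set: 'I_d])
    ((@tnth d R)^~ i @^-1` `[0%R, 1%R])); last first.
  apply/seteqP; split => x xc i; last by have := xc i I; rewrite /= in_itv.
  by move=> _; rewrite /= in_itv; exact: xc.
apply: fin_bigcap_measurable => // i _.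
by rewrite -[X in measurable X]setTI; exact: measurable_tnth.
Qed.

Lemma node_law_holder_class (C : R) s : (L * Num.sqrt M <= C)%R ->
  holder_class h C M (node_law s).
Proof.
move=> LMC; split.
  exists (~` @unit_cube R d); split => //.
    by apply: measurableC; exact: measurable_unit_cube.
  have mc : measurable (~` @unit_cube R d).
    by apply: measurableC; exact: measurable_unit_cube.
  have mf : measurable ((@fst (d.-tuple R) R) @^-1` (~` @unit_cube R d)).
    by rewrite -[X in measurable X]setTI; exact: measurable_fst.
  transitivity (node_law s (@fst (d.-tuple R) R @^-1` (~` @unit_cube R d))) => //.
  rewrite -[X in node_law s X]setIT -integral_indic// ge0_integral_node_law//; last first.
    by apply/measurable_EFinP; exact: measurable_indic.
  rewrite big1// => i _; rewrite indicE memNset ?mule0//=.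
  by apply; exact: node_cube.
exists (spike_cdf s); split; first exact: spike_cdf_cond.
  by move=> x _; exact: spike_cdf_dispersion.
move=> x x' _ _; have C0 : (0 <= C)%R by apply: le_trans LMC; rewrite mulr_ge0 ?sqrtr_ge0.
rewrite Lnorm2_le ?mulr_ge0 ?powR_ge0// spike_cdf_L2 lee_fin.
rewrite -[X in (_ * X <= _)%R](sqr_sqrtr (ltW M0)) -exprMn.
rewrite -[leLHS]real_normK ?num_real// ler_sqr ?nnegrE ?mulr_ge0 ?powR_ge0//.
rewrite normrM [X in (_ * X)%R]ger0_norm ?sqrtr_ge0//.
have h0 : (0 <= h)%R by case/andP: h01 => /ltW.
apply: (@le_trans _ _ (L * sup_dist x' x `^ h * Num.sqrt M)%R).
  by rewrite ler_wpM2r ?sqrtr_ge0//; exact: spike_holder.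
rewrite mulrAC; apply: ler_pM; rewrite ?mulr_ge0 ?powR_ge0 ?sqrtr_ge0//.
by rewrite ge0_ler_powR ?nnegrE ?sup_dist_ge0 ?sqrtr_ge0// sup_dist_le_enorm.
Qed.


Lemma spike_cdf_node s j z : (0 <= z < M)%R ->
  spike_cdf s (node j) z = vertex_prob cell_gap s j.
Proof.
move=> /andP[z0 zM]; rewrite spike_cdfE spike_at_node z0 leNgt zM /vertex_prob/=.
by rewrite mulr0 add0r mulr1.
Qed.

Lemma hypercube_lower_bound n (Fhat : n.-tuple (d.-tuple R * R) ->
    d.-tuple R -> cumulativeBounded (0 : R)%R (1 : R)%R) :
  predictors Fhat -> (n%:R * (4 * cell_gap ^+ 2 / #|J|%:R) <= 2^-1)%R ->
  exists s, (cell_gap ^+ 2 / 6 * M)%:E <=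
    expected_risk (node_law s) Fhat - risk (node_law s) (spike_cdf s).
Proof.
move=> mFhat ngap.
pose u z (j : J) (t : n.-tuple (J * bool)) :=
  Fhat [tuple of map node_atom t] (node j) z.
pose G s z : R := (\sum_(t : n.-tuple (J * bool))
  (\prod_(i <- t) vertex_weight cell_gap s i) *
  \sum_(i : J * bool) vertex_weight cell_gap s i *
     (u z i.1 t - spike_cdf s (node i.1) z) ^+ 2)%R.
have w0 s i := ltW (vertex_weight_gt0 card_node_gt0 cell_gap_ge0 cell_gap_le s i).
have G0 s z : (0 <= G s z)%R.
  apply: sumr_ge0 => t _; apply: mulr_ge0; first by apply: prodr_ge0.
  by apply: sumr_ge0 => i _; rewrite mulr_ge0 ?sqr_ge0.
have mcdf (F : cumulativeBounded (0 : R)%R (1 : R)%R) : measurable_fun [set: R] F.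
  by apply: nondecreasing_measurable => //; exact: cumulative_is_nondecreasing.
have mG s : measurable_fun [set: R] (G s).
  apply: measurable_sum => t; apply: measurable_funM => //.
  apply: measurable_sum => i; apply: measurable_funM => //.
  by apply: measurable_funX; apply: measurable_funB; exact: mcdf.
have excessE s : expected_risk (node_law s) Fhat - risk (node_law s) (spike_cdf s) =
    \int[lebesgue_measure]_z (G s z)%:E.
  have risk_fin : risk (node_law s) (spike_cdf s) \is a fin_num.
    rewrite ge0_fin_numE; last first.
      by do 2 (apply: integral_ge0 => ? _); rewrite lee_fin sqr_ge0.
    by apply: le_lt_trans (risk_le (spike_cdf_cond s) (spike_cdf_dispersion s)) (ltry _).
  rewrite (expected_risk_decomp (spike_cdf_cond s) mFhat) addeAC subee// add0e.
  apply: eq_integral => z _.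
  pose f (v : n.-tuple (d.-tuple R * R) * (d.-tuple R * R)) : \bar R :=
    ((Fhat v.1 v.2.1 z - spike_cdf s v.2.1 z) ^+ 2)%:E.
  have f0 v : 0 <= f v by rewrite lee_fin sqr_ge0.
  have mf : measurable_fun setT f.
    apply/measurable_EFinP; apply: measurable_funX; apply: measurable_funB.
      apply: (measurableT_comp (g := fun v : n.-tuple (d.-tuple R * R) *
        (d.-tuple R * R) => (v.1, v.2.1)) (mFhat z)).
      apply: measurable_fun_pair => //=.
      exact: (measurableT_comp (f := fst)).
    apply: (measurableT_comp (g := fun v : n.-tuple (d.-tuple R * R) *
        (d.-tuple R * R) => v.2.1) (measurable_spike_cdf s z)).
    exact: (measurableT_comp (f := fst)).
  rewrite ge0_integral_sample_atomic_law; last 2 first.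
  - exact: (measurable_fun_fubini_tonelli_F (m2 := node_law s) f).
  - by move=> D; apply: integral_ge0 => v _; exact: (f0 (D, v)).
  rewrite -sumEFin; apply: eq_bigr => t _; rewrite EFinM; congr (_ * _).
  rewrite ge0_integral_node_law; last 2 first.
  - exact: (measurableT_comp mf (pair1_measurable _)).
  - by move=> v; exact: (f0 (_, v)).
  by rewrite -sumEFin; apply: eq_bigr => i _; rewrite EFinM.
apply: contrapT => /forallNP noE.
have E_lt s : \int[lebesgue_measure]_z (G s z)%:E < (cell_gap ^+ 2 / 6 * M)%:E.
  by rewrite ltNge -excessE; apply/negP; exact: noE.
have E_ge0 s : 0 <= \int[lebesgue_measure]_z (G s z)%:E.
  by apply: integral_ge0 => z _; rewrite lee_fin.
have : \sum_(s : {ffun J -> bool}) (cell_gap ^+ 2 / 6 * M)%:E <=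
    \sum_(s : {ffun J -> bool}) \int[lebesgue_measure]_z (G s z)%:E.
  rewrite -ge0_integral_sum//; last 2 first.
  - by move=> s; apply/measurable_EFinP; exact: mG.
  - by move=> s z _; rewrite lee_fin.
  rewrite [leLHS](_ : _ = \int[lebesgue_measure]_z
      ((\sum_(s : {ffun J -> bool}) cell_gap ^+ 2 / 6)%:E * (\1_`[0%R, M[ z)%:E)); last first.
    rewrite ge0_integralZl_EFin//; last 2 first.
    - by apply/measurable_EFinP; exact: measurable_indic.
    - by apply: sumr_ge0 => s _; rewrite divr_ge0 ?sqr_ge0.
    by rewrite integral_indic_itv0 ?ltW// -EFinM sumEFin mulr_suml.
  apply: ge0_le_integral => //.
  - move=> z _; rewrite -EFinM lee_fin mulr_ge0//.
    by apply: sumr_ge0 => s _; rewrite divr_ge0 ?sqr_ge0.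
  - apply/measurable_EFinP; apply: measurable_funM => //; exact: measurable_indic.
  - by apply: emeasurable_sum => s; apply/measurable_EFinP; exact: mG.
  move=> z _; rewrite -EFinM sumEFin lee_fin indicE mem_setE in_itv/=.
  case: (boolP (0 <= z < M)%R) => zM; last by rewrite mulr0 sumr_ge0.
  rewrite mulr1.
  apply: le_trans (hypercube_bound card_node_gt0 cell_gap_ge0 cell_gap_le (u z) ngap) _.
  rewrite le_eqVlt; apply/orP; left; apply/eqP.
  apply: eq_bigr => s _; apply: eq_bigr => t _; congr (_ * _)%R.
  by apply: eq_bigr => i _; rewrite spike_cdf_node.
have E_fin s : \int[lebesgue_measure]_z (G s z)%:E =
    (fine (\int[lebesgue_measure]_z (G s z)%:E))%:E.
  by rewrite fineK// ge0_fin_numE// (lt_trans (E_lt s)) ?ltry.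
rewrite (eq_bigr _ (fun s _ => E_fin s)) !sumEFin lee_fin leNgt => /negP; apply.
apply: ltr_sum; last by move=> s _; rewrite -lte_fin -E_fin.
by apply/hasP; exists [ffun=> false]; rewrite ?mem_index_enum.
Qed.

End lower_family.

Section rate.
Context {R : realType}.

Lemma limn_esup_le (u : nat -> \bar R) (c : \bar R) :
  (forall n, (0 < n)%N -> u n <= c) -> limn_esup u <= c.
Proof.
move=> uc; apply: (@le_trans _ _ (ereal_sup [set u n | n in [set n | (0 < n)%N]])).
  by apply: ereal_inf_lbound; exists [set n | (0 < n)%N] => //; exists 1%N.
by apply: ge_ereal_sup => _ [n /= n0 <-]; exact: uc.
Qed.

Lemma limn_einf_ge (u : nat -> \bar R) (c : \bar R) :
  (forall n, (0 < n)%N -> c <= u n) -> c <= limn_einf u.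
Proof.
by move=> uc; rewrite /limn_einf leeNr; apply: limn_esup_le => n n0; rewrite leeN2 uc.
Qed.

Context {d : nat} (h : R).
Hypothesis h01 : (0 < h <= 1)%R.

Definition minimax_rate (n : nat) : R := (n%:R `^ (- (2 * h / (2 * h + d%:R))))%R.

Lemma minimax_rate_gt0 n : (0 < n)%N -> (0 < minimax_rate n)%R.
Proof. by move=> n0; rewrite powR_gt0// ltr0n. Qed.

(* [m] is the number of cells per coordinate balancing the squared bias
   [m ^ (-2h)] with the variance [m ^ d / n]. *)
Lemma minimax_resolution n : (0 < n)%N -> exists m : nat,
  [/\ (0 < m)%N,
      ((m%:R `^ h) ^- 2 <= minimax_rate n)%R,
      (minimax_rate n <= 4 * (m%:R `^ h) ^- 2)%R,
      (n%:R <= (m%:R `^ h) ^+ 2 * m%:R ^+ d :> R)%R &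
      (m%:R ^+ d <= 2 ^+ d * (n%:R * minimax_rate n) :> R)%R].
Proof.
move=> n0; case/andP: (h01) => h0 h1.
have hd0 : (0 < 2 * h + d%:R)%R by rewrite ltr_wpDr ?mulr_gt0.
pose r : R := (n%:R `^ (2 * h + d%:R)^-1)%R.
have r0 : (0 < r)%R by rewrite powR_gt0 ?ltr0n.
have r1 : (1 <= r)%R.
  by rewrite /r -[leLHS](powRr0 n%:R) ler_powR ?ler1n// invr_ge0 ltW.
have rate : (minimax_rate n = (r `^ h) ^- 2)%R.
  rewrite -powR_mulrn ?powR_ge0// -powRrM -powRN -powRrM; congr (_ `^ _)%R.
  by field; rewrite lt0r_neq0.
have nE : (n%:R = (r `^ h) ^+ 2 * r ^+ d :> R)%R.
  rewrite -!powR_mulrn ?powR_ge0 ?ltW// -powRrM -powRD; last first.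
    by rewrite lt0r_neq0 ?implybT.
  by rewrite -powRrM [(h * _)%R]mulrC mulVf ?powRr1 ?ler0n// lt0r_neq0.
have /andP[rl rm] := truncn_itv (ltW r0).
exists (Num.truncn r).+1.
set m : R := (Num.truncn r).+1%:R.
have m2 : (m <= 2 * r)%R by rewrite /m -natr1; lra.
have m0 : (0 < m)%R by rewrite ltr0n.
have rhm : (r `^ h <= m `^ h)%R.
  by apply: ge0_ler_powR; rewrite ?nnegrE; exact: ltW.
have mhr : (m `^ h <= 2 * r `^ h)%R.
  apply: (@le_trans _ _ ((2 * r) `^ h)%R).
    by apply: ge0_ler_powR => //; rewrite ?nnegrE ?mulr_ge0// ltW.
  rewrite (powRM _ (ler0n _ 2) (ltW r0)); apply: ler_wpM2r; first exact: powR_ge0.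
  by apply: ler1_powR => //; rewrite ler1n.
have rh0 : (0 < r `^ h)%R by rewrite powR_gt0.
have mh0 : (0 < m `^ h)%R by rewrite powR_gt0.
split=> //.
- by rewrite rate lef_pV2 ?posrE ?exprn_gt0// lerXn2r ?nnegrE ?powR_ge0.
- rewrite rate -[4%R]invrK -invfM lef_pV2 ?posrE ?mulr_gt0 ?exprn_gt0//.
  rewrite ler_pdivrMl//.
  have := lerXn2r 2 (powR_ge0 m h) (mulr_ge0 (ler0n _ 2) (powR_ge0 r h)) mhr.
  by rewrite exprMn; lra.
- rewrite nE; apply: ler_pM.
  + by rewrite exprn_ge0 ?powR_ge0.
  + by rewrite exprn_ge0 ?ltW.
  + by rewrite lerXn2r ?nnegrE ?powR_ge0.
  + by apply: lerXn2r; rewrite ?nnegrE; exact: ltW.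
- rewrite rate nE mulrAC mulfV ?mul1r ?expf_neq0 ?lt0r_neq0// -exprMn.
  by apply: lerXn2r => //; rewrite ?nnegrE ?mulr_ge0// ltW.
Qed.

End rate.

Lemma minimax_ratio_lower (R : realType) (d : nat) (h C M : R) :
  (0 < h <= 1)%R -> (0 < C)%R -> (0 < M)%R ->
  exists2 c : R, (0 < c)%R & forall n, (0 < n)%N ->
    c%:E <= minimax_ratio (@holder_class R d h C M) (@minimax_rate R d h) n.
Proof.
move=> h01 C0 M0.
have sM0 : (0 < Num.sqrt M)%R by rewrite sqrtr_gt0.
pose L : R := Num.min (C / Num.sqrt M)%R 4^-1%R.
have L0 : (0 < L)%R by rewrite lt_min divr_gt0//= invr_gt0.
have L1 : (L <= 4^-1)%R by rewrite ge_min lexx orbT.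
have LC : (L * Num.sqrt M <= C)%R by rewrite -ler_pdivlMr// ge_min lexx.
exists (L ^+ 2 * M / 24)%R; first by rewrite divr_gt0// mulr_gt0// exprn_gt0.
move=> n n0; have an0 := @minimax_rate_gt0 R d h n n0.
have [m [m0 _ an_le n_le _]] := @minimax_resolution R d h h01 n n0.
apply: le_ereal_inf_tmp => _ [Fhat mFhat <-].
have mh0 : (0 < m%:R `^ h :> R)%R by rewrite powR_gt0// ltr0n.
have gapE : (@cell_gap R m h L ^+ 2 = L ^+ 2 * (m%:R `^ h) ^- 2)%R.
  by rewrite /cell_gap exprMn powRN exprVn.
have [|s Hs] := @hypercube_lower_bound R d m h L M m0 h01 (ltW L0) L1 M0 n Fhat mFhat.
  rewrite gapE card_node natrX.
  have md0 : (0 < m%:R ^+ d :> R)%R by rewrite exprn_gt0// ltr0n.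
  rewrite (_ : _ * _ = (4 * L ^+ 2) * (n%:R / ((m%:R `^ h) ^+ 2 * m%:R ^+ d)))%R; last first.
    by field; rewrite !lt0r_neq0.
  have q1 : (n%:R / ((m%:R `^ h) ^+ 2 * m%:R ^+ d) <= 1 :> R)%R.
    by rewrite ler_pdivrMr ?mul1r// mulr_gt0// exprn_gt0.
  have q0 : (0 <= n%:R / ((m%:R `^ h) ^+ 2 * m%:R ^+ d) :> R)%R.
    by rewrite divr_ge0// mulr_ge0 ?exprn_ge0 ?powR_ge0.
  have L2 : (4 * L ^+ 2 <= 2^-1)%R by have := L0; have := L1; nra.
  apply: le_trans L2; rewrite ler_piMr// mulr_ge0// sqr_ge0//.
apply: le_ereal_sup_tmp.
exists ((expected_risk (node_law M m0 h01 (ltW L0) L1 s) Fhat -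
  risk (node_law M m0 h01 (ltW L0) L1 s) (spike_cdf M m0 h01 (ltW L0) L1 s)) /
  (@minimax_rate R d h n)%:E).
  exists (node_law M m0 h01 (ltW L0) L1 s), (spike_cdf M m0 h01 (ltW L0) L1 s).
  split => //; first exact: node_law_holder_class.
  exact: spike_cdf_cond.
rewrite inver gt_eqF// lee_pdivlMr//; apply: le_trans Hs.
rewrite -EFinM lee_fin gapE.
have : (L ^+ 2 * M * @minimax_rate R d h n <= L ^+ 2 * M * (4 * (m%:R `^ h) ^- 2))%R.
  by rewrite ler_wpM2l// mulr_ge0 ?sqr_ge0 ?ltW.
lra.
Qed.

(** * Upper bound *)

Section clip.
Context {R : realType} {d : nat}.
Implicit Types x : d.-tuple R.

Definition clip x : d.-tuple R :=
  [tuple Num.max 0%R (Num.min (tnth x i) 1%R) | i < d].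

Lemma clip_cube x : unit_cube (clip x).
Proof.
by move=> i; rewrite tnth_mktuple le_max lexx/= ge_max ler01 ge_min lexx orbT.
Qed.

Lemma clip_id x : unit_cube x -> clip x = x.
Proof.
move=> xc; apply: eq_from_tnth => i; rewrite tnth_mktuple.
by have /andP[x0 x1] := xc i; rewrite (min_idPl x1) (max_idPr x0).
Qed.

Lemma measurable_clip : measurable_fun [set: d.-tuple R] clip.
Proof.
apply/measurable_fun_tnthP => i.
rewrite (_ : _ \o _ = fun x => Num.max 0%R (Num.min (tnth x i) 1%R)); last first.
  by apply/funext => x /=; rewrite tnth_mktuple.
apply: measurable_maxr => //; apply: measurable_minr => //.
exact: measurable_tnth.
Qed.

Lemma cond_cdf_clip (P : probability (d.-tuple R * R)%type R) F :
  {ae distribution P fst, forall x, unit_cube x} ->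
  is_cond_cdf P F -> is_cond_cdf P (F \o clip).
Proof.
move=> cubeP PF.
have mFc z : measurable_fun [set: d.-tuple R] (fun x => F (clip x) z).
  exact: (measurableT_comp (PF.1 z) measurable_clip).
split=> // A y mA; rewrite PF.2//; apply: ge0_ae_eq_integral => //.
- by apply/measurable_EFinP; apply: measurable_funTS; exact: PF.1.
- by apply/measurable_EFinP; apply: measurable_funTS; exact: mFc.
- by move=> x _; rewrite lee_fin cumulative01_ge0.
- by move=> x _; rewrite lee_fin cumulative01_ge0.
by apply: filterS cubeP => x xc _ /=; rewrite clip_id.
Qed.

Context (m : nat).
Hypothesis m0 : (0 < m)%N.

Definition grid_cell x : {ffun 'I_d -> 'I_m.+1} :=
  [ffun i => inord (Num.truncn (m%:R * tnth (clip x) i)%R)].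

Let coord_ge0 x i : (0 <= m%:R * tnth (clip x) i)%R.
Proof. by rewrite mulr_ge0//; case/andP: (clip_cube x i). Qed.

Let truncn_coord_lt x i : (Num.truncn (m%:R * tnth (clip x) i)%R < m.+1)%N.
Proof.
rewrite ltnS -(ler_nat R); have /andP[tl _] := truncn_itv (coord_ge0 x i).
apply: le_trans tl _; rewrite ler_piMr//.
by case/andP: (clip_cube x i).
Qed.

Lemma grid_cell_dist x y i : grid_cell x = grid_cell y ->
  (`|tnth (clip x) i - tnth (clip y) i| <= m%:R^-1)%R.
Proof.
move=> /ffunP/(_ i); rewrite !ffunE => /(congr1 val)/=.
rewrite !inordK// => xy.
have := truncn_itv (coord_ge0 x i); have := truncn_itv (coord_ge0 y i).
rewrite xy -natr1; set t := (Num.truncn _)%:R => /andP[yl yr] /andP[xl xr].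
have mR : (0 < m%:R :> R)%R by rewrite ltr0n.
rewrite -(ler_pM2l mR) mulfV ?lt0r_neq0// -[X in (X * _ <= _)%R](gtr0_norm mR).
rewrite -normrM mulrBr ler_norml; lra.
Qed.

Lemma measurable_grid_cell c : measurable [set x | grid_cell x = c].
Proof.
rewrite (_ : mkset _ = \bigcap_(i in [set: 'I_d])
    ((fun x => m%:R * tnth (clip x) i)%R @^-1` `[(c i)%:R, (c i).+1%:R[)); last first.
  apply/seteqP; split => x /=.
    move=> <- i _ /=; rewrite in_itv/= ffunE inordK//.
    exact: truncn_itv.
  move=> xc; apply/ffunP => i; apply/val_inj => /=.
  rewrite ffunE inordK//; have := xc i I; rewrite /= in_itv/= => xci.
  by apply: truncn_def.
apply: fin_bigcap_measurable => // i _.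
rewrite -[X in measurable X]setTI.
apply: measurable_funM => //.
exact: (measurableT_comp (measurable_tnth i) measurable_clip).
Qed.

End clip.

Section counting.
Context dT {T : measurableType dT} {R : realType} (P : probability T R).

Local Notation count_in B n := (fun D : n.-tuple T => count B D).

Lemma measurable_count (B : pred T) n : measurable_fun [set: T] B ->
  measurable_fun [set: n.-tuple T] (count_in B n).
Proof.
move=> mB.
under eq_fun do rewrite -sum1_count big_mkcond big_tuple.
elim: (index_enum _) => [|i r IHr].
  by under eq_fun do rewrite big_nil; exact: measurable_cst.
under eq_fun do rewrite big_cons; apply: measurable_fun_addn => //.
apply: (measurableT_comp (f := fun b : bool => (if b then 1 else 0)%N)) => //.
by apply: (measurableT_comp mB); exact: measurable_tnth.
Qed.

Fixpoint binomial_mean (p : R) n (f : nat -> R) : R :=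
  if n is n'.+1 then
    (p * binomial_mean p n' (f \o S) + (1 - p) * binomial_mean p n' f)%R
  else f 0%N.

Lemma binomial_mean_ge0 p n f : (0 <= p <= 1)%R -> (forall k, 0 <= f k)%R ->
  (0 <= binomial_mean p n f)%R.
Proof.
move=> p01; elim: n f => [|n IHn] f f0 //=; case/andP: (p01) => p0 p1.
by rewrite addr_ge0// mulr_ge0 ?subr_ge0 ?IHn//= => k; exact: f0.
Qed.

Lemma binomial_meanD p n f g : binomial_mean p n (fun k => f k + g k)%R =
  (binomial_mean p n f + binomial_mean p n g)%R.
Proof.
elim: n f g => [|n IHn] f g //=.
by rewrite (IHn (f \o S) (g \o S)) IHn; ring.
Qed.

Lemma eq_binomial_mean p n f g : f =1 g -> binomial_mean p n f = binomial_mean p n g.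
Proof. by move=> /funext ->. Qed.

Lemma binomial_mean_size_bias p n f :
  (n.+1%:R * p * binomial_mean p n (f \o S))%R =
  binomial_mean p n.+1 (fun k => k%:R * f k)%R.
Proof.
elim: n f => [|n IHn] f; first by rewrite /= mul0r mulr0 addr0; ring.
have meanS n' g : binomial_mean p n'.+1 g =
  (p * binomial_mean p n' (g \o S) + (1 - p) * binomial_mean p n' g)%R by [].
rewrite [RHS]meanS -IHn.
have -> : binomial_mean p n.+1 ((fun k => k%:R * f k)%R \o S) =
    (binomial_mean p n.+1 (f \o S) + n.+1%:R * p * binomial_mean p n (f \o S \o S))%R.
  rewrite IHn -binomial_meanD; apply: eq_binomial_mean => k /=.
  by rewrite -natr1; ring.
by rewrite [binomial_mean p n.+1 _]meanS -[n.+2%:R]natr1; ring.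
Qed.

Lemma binomial_mean_le1 p n f : (0 <= p <= 1)%R -> (forall k, f k <= 1)%R ->
  (binomial_mean p n f <= 1)%R.
Proof.
move=> p01; elim: n f => [|n IHn] f f1 //=; case/andP: (p01) => p0 p1.
have := IHn _ f1; have := IHn (f \o S) (fun k => f1 k.+1); nra.
Qed.

Lemma binomial_mean_inv p n : (0 <= p <= 1)%R ->
  (n.+1%:R * p * binomial_mean p n (fun k => k.+1%:R^-1) <= 1)%R.
Proof.
move=> p01; rewrite (binomial_mean_size_bias p n (fun k => k%:R^-1)%R).
apply: binomial_mean_le1 => // -[|k]; first by rewrite mul0r.
by rewrite mulfV// pnatr_eq0.
Qed.

Lemma measurable_fun_count (B : pred T) n (f : nat -> R) :
  measurable_fun [set: T] B ->
  measurable_fun [set: n.-tuple T] (fun D => f (count B D)).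
Proof.
by move=> mB; apply: (measurableT_comp (f := f)) => //; exact: measurable_count.
Qed.

Lemma integral_sample_count (B : pred T) (p : R) n (f : nat -> R) :
  measurable_fun [set: T] B -> \int[P]_u ((B u)%:R)%:E = p%:E ->
  (forall k, 0 <= f k)%R ->
  \int[sample_law P n]_D (f (count B D))%:E = (binomial_mean p n f)%:E.
Proof.
move=> mB Pp.
have mBR : measurable_fun [set: T] (fun u => ((B u)%:R : R)).
  by apply: (measurableT_comp (f := fun b : bool => b%:R : R)).
have mBR' : measurable_fun [set: T] (fun u => (1 - (B u)%:R : R)%R).
  exact: measurable_funB.
have PpC : \int[P]_u (1 - (B u)%:R)%:E = (1 - p)%:E.
  have : \int[P]_u (1 - (B u)%:R)%:E + \int[P]_u ((B u)%:R)%:E = 1.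
    rewrite -ge0_integralD//.
    - under eq_integral do rewrite -EFinD subrK.
      exact: integral_cst_probability.
    - by move=> u _; rewrite lee_fin subr_ge0; case: (B u).
    - exact/measurable_EFinP.
    - by apply/measurable_EFinP.
  by rewrite Pp => /(congr1 (fun e => e - p%:E)); rewrite addeK.
have p01 : (0 <= p <= 1)%R.
  apply/andP; split.
    by rewrite -lee_fin -Pp; apply: integral_ge0 => u _; rewrite lee_fin.
  rewrite -subr_ge0 -lee_fin -PpC; apply: integral_ge0 => u _.
  by rewrite lee_fin subr_ge0; case: (B u).
elim: n f => [|n IHn] f f0.
  rewrite ge0_integral_sample_law0// => [|D]; last by rewrite lee_fin.
  by apply/measurable_EFinP; exact: measurable_fun_count.
rewrite ge0_integral_sample_law_cons//; last 2 first.
- by apply/measurable_EFinP; exact: measurable_fun_count.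
- by move=> D; rewrite lee_fin.
have m0 : (0 <= binomial_mean p n f)%R by exact: binomial_mean_ge0.
have m1 : (0 <= binomial_mean p n (f \o S))%R.
  by apply: binomial_mean_ge0 => // k; exact: f0.
transitivity (\int[P]_u ((binomial_mean p n (f \o S))%:E * ((B u)%:R)%:E +
    (binomial_mean p n f)%:E * (1 - (B u)%:R)%:E)).
  apply: eq_integral => u _; rewrite -!EFinM -EFinD /=.
  case: (B u) => /=.
    by rewrite subrr mulr0 addr0 mulr1 -IHn//; move=> k; exact: f0.
  by rewrite mulr0 add0r subr0 mulr1 -IHn.
rewrite ge0_integralD//.
- rewrite !ge0_integralZl_EFin//.
  + by rewrite Pp PpC -!EFinM -EFinD mulrC [X in (_ + X)%R]mulrC.
  + by move=> u _; rewrite lee_fin subr_ge0; case: (B u).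
  + exact/measurable_EFinP.
  + exact/measurable_EFinP.
- by move=> u _; rewrite mule_ge0 ?lee_fin.
- by apply/measurable_EFinP; exact: measurable_funM.
- by move=> u _; rewrite mule_ge0 ?lee_fin// subr_ge0; case: (B u).
- by apply/measurable_EFinP; exact: measurable_funM.
Qed.

End counting.

Section conditional_variance.
Context {R : realType} {d : nat} (P : probability (d.-tuple R * R)%type R).
Variable F : d.-tuple R -> cumulativeBounded (0 : R)%R (1 : R)%R.
Hypothesis PF : is_cond_cdf P F.
Variable z : R.

Local Notation T := (d.-tuple R).
Local Notation Z := (d.-tuple R * R)%type.

Definition inputs n (D : n.-tuple Z) : n.-tuple T := [tuple of map fst D].

Lemma measurable_inputs n : measurable_fun [set: n.-tuple Z] (@inputs n).
Proof.
apply/measurable_fun_tnthP => i.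
rewrite (_ : _ \o _ = fst \o (@tnth n Z)^~ i); last first.
  by apply/funext => D /=; rewrite tnth_map.
by apply: measurableT_comp => //; exact: measurable_tnth.
Qed.

Definition residual (u : Z) : R := ((u.2 <= z)%R%:R - F u.1 z)%R.

Definition dispersion (x : T) : R := (F x z * (1 - F x z))%R.

Lemma measurable_residual : measurable_fun [set: Z] residual.
Proof.
by apply: measurable_funB; [exact: measurable_snd_le|exact: (measurable_cond_cdf PF)].
Qed.

Lemma measurable_dispersion : measurable_fun [set: T] dispersion.
Proof.
apply: measurable_funM; first exact: PF.1.
by apply: measurable_funB => //; exact: PF.1.
Qed.

Lemma dispersion_ge0 x : (0 <= dispersion x)%R.
Proof. by rewrite mulr_ge0 ?subr_ge0 ?cumulative01_ge0 ?cumulative01_le1. Qed.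

Lemma integral_residual (b w s : T -> R) :
  measurable_fun [set: T] b -> measurable_fun [set: T] w ->
  measurable_fun [set: T] s -> (forall x, 0 <= s x)%R ->
  \int[P]_u ((b u.1 + w u.1 * residual u) ^+ 2 + s u.1)%:E =
  \int[P]_u (b u.1 ^+ 2 + (w u.1 ^+ 2 * dispersion u.1 + s u.1))%:E.
Proof.
move=> mb mw ms s0; have mF := PF.1 z.
transitivity (\int[P]_u (
    ((b u.1 + w u.1 * (1 - F u.1 z)) ^+ 2 + s u.1) * (u.2 <= z)%R%:R +
    ((b u.1 - w u.1 * F u.1 z) ^+ 2 + s u.1) * (1 - (u.2 <= z)%R%:R))%:E).
  apply: eq_integral => u _; congr EFin; rewrite /residual.
  by case: (u.2 <= z)%R => /=; ring.
rewrite (@cond_cdf_integral _ _ P F PF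
   (fun x => (b x + w x * (1 - F x z)) ^+ 2 + s x)%R
   (fun x => (b x - w x * F x z) ^+ 2 + s x)%R z).
- by apply: eq_integral => u _; congr EFin; rewrite /dispersion; ring.
- apply: measurable_funD => //; apply: measurable_funX; apply: measurable_funD => //.
  by apply: measurable_funM => //; exact: measurable_funB.
- apply: measurable_funD => //; apply: measurable_funX; apply: measurable_funB => //.
  exact: measurable_funM.
- by move=> x; rewrite addr_ge0 ?sqr_ge0.
- by move=> x; rewrite addr_ge0 ?sqr_ge0.
Qed.

(* Given the inputs, the residuals are centred and uncorrelated. *)
Lemma integral_weighted_residuals n (b : n.-tuple T -> R)
    (w : 'I_n -> n.-tuple T -> R) :
  measurable_fun [set: n.-tuple T] b ->
  (forall i, measurable_fun [set: n.-tuple T] (w i)) ->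
  \int[sample_law P n]_D
    ((b (inputs D) + \sum_(i < n) w i (inputs D) * residual (tnth D i)) ^+ 2)%:E =
  \int[sample_law P n]_D
    (b (inputs D) ^+ 2 + \sum_(i < n) w i (inputs D) ^+ 2 * dispersion (tnth D i).1)%:E.
Proof.
elim: n b w => [|n IHn] b w mb mw.
  by apply: eq_integral => D _; rewrite !big_ord0 !addr0.
have mres n' i : measurable_fun [set: n'.-tuple Z] (fun D => residual (tnth D i)).
  by apply: (measurableT_comp measurable_residual); exact: measurable_tnth.
have mdis n' i : measurable_fun [set: n'.-tuple Z] (fun D => dispersion (tnth D i).1).
  apply: (measurableT_comp measurable_dispersion).
  by apply: (measurableT_comp (f := fst)) => //; exact: measurable_tnth.
have min n' (g : n'.-tuple T -> R) : measurable_fun setT g ->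
    measurable_fun setT (fun D => g (inputs D)).
  by move=> mg; exact: (measurableT_comp mg (@measurable_inputs n')).
rewrite ge0_integral_sample_law_cons; last 2 first.
- apply/measurable_EFinP; apply: measurable_funX; apply: measurable_funD; first exact: (min _ _ mb).
  by apply: measurable_sum => i; apply: measurable_funM; [exact: (min _ _ (mw i))|exact: mres].
- by move=> D; rewrite lee_fin sqr_ge0.
rewrite [RHS]ge0_integral_sample_law_cons; last 2 first.
- apply/measurable_EFinP; apply: measurable_funD.
    by apply: measurable_funX; exact: (min _ _ mb).
  apply: measurable_sum => i; apply: measurable_funM; last exact: mdis.
  by apply: measurable_funX; exact: (min _ _ (mw i)).
- move=> D; rewrite lee_fin addr_ge0 ?sqr_ge0// sumr_ge0// => i _.
  by rewrite mulr_ge0 ?sqr_ge0 ?dispersion_ge0.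
pose c x (ts : n.-tuple T) : n.+1.-tuple T := [tuple of x :: ts].
have mc2 : measurable_fun setT (fun v : T * n.-tuple T => c v.1 v.2).
  exact: measurable_cons_tuple.
have inputsE (u : Z) (D : n.-tuple Z) :
    inputs ([tuple of u :: D] : n.+1.-tuple Z) = c u.1 (inputs D).
  exact/val_inj.
have tnth_lift (u : Z) (D : n.-tuple Z) i :
    tnth ([tuple of u :: D] : n.+1.-tuple Z) (lift ord0 i) = tnth D i.
  by rewrite tnthS.
have tnth_0 (u : Z) (D : n.-tuple Z) :
    tnth ([tuple of u :: D] : n.+1.-tuple Z) ord0 = u.
  by rewrite tnth0.
pose S x (D : n.-tuple Z) := (\sum_(i < n) w (lift ord0 i) (c x (inputs D)) ^+ 2
  * dispersion (tnth D i).1)%R.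
have S0 x D : (0 <= S x D)%R.
  by apply: sumr_ge0 => i _; rewrite mulr_ge0 ?sqr_ge0 ?dispersion_ge0.
transitivity (\int[P]_u \int[sample_law P n]_D
  ((b (c u.1 (inputs D)) + w ord0 (c u.1 (inputs D)) * residual u) ^+ 2 + S u.1 D)%:E).
  apply: eq_integral => u _.
  have mcu : measurable_fun setT (c u.1).
    exact: (measurableT_comp mc2 (pair1_measurable u.1)).
  have mcomp (g : n.+1.-tuple T -> R) : measurable_fun setT g ->
      measurable_fun setT (fun ts => g (c u.1 ts)).
    by move=> mg; exact: (measurableT_comp mg mcu).
  rewrite -(IHn (fun ts => b (c u.1 ts) + w ord0 (c u.1 ts) * residual u)%R
    (fun i ts => w (lift ord0 i) (c u.1 ts))).
  - apply: eq_integral => D _; congr ((_ ^+ 2)%:E).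
    rewrite big_ord_recl inputsE tnth_0 addrA; congr (_ + _)%R.
    by apply: eq_bigr => i _; rewrite tnth_lift.
  - apply: measurable_funD; first exact: mcomp.
    by apply: measurable_funM => //; exact: mcomp.
  - by move=> i; exact: mcomp.
have mcuD (g : n.+1.-tuple T -> R) : measurable_fun setT g ->
    measurable_fun setT (fun v : Z * n.-tuple Z => g (c v.1.1 (inputs v.2))).
  move=> mg; apply: (measurableT_comp mg).
  apply: (measurableT_comp (g := fun v : Z * n.-tuple Z => (v.1.1, inputs v.2)) mc2).
  apply: measurable_fun_pair => /=; first exact: (measurableT_comp (f := fst)).
  by apply: measurableT_comp => //; exact: measurable_inputs.
have mS : measurable_fun setT (fun v : Z * n.-tuple Z => S v.1.1 v.2).
  apply: measurable_sum => i; apply: measurable_funM.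
    by apply: measurable_funX; exact: mcuD.
  exact: (measurableT_comp (mdis _ i)).
rewrite (fubini_tonelli (m1 := P) (m2 := sample_law P n) (fun v => ((b (c v.1.1 (inputs v.2))
  + w ord0 (c v.1.1 (inputs v.2)) * residual v.1) ^+ 2 + S v.1.1 v.2)%:E)); last 2 first.
- apply/measurable_EFinP; apply: measurable_funD => //.
  apply: measurable_funX; apply: measurable_funD; first exact: mcuD.
  apply: measurable_funM; first exact: mcuD.
  exact: (measurableT_comp measurable_residual).
- by move=> v; rewrite lee_fin addr_ge0 ?sqr_ge0.
transitivity (\int[sample_law P n]_D \int[P]_u
  (b (c u.1 (inputs D)) ^+ 2 +
   (w ord0 (c u.1 (inputs D)) ^+ 2 * dispersion u.1 + S u.1 D))%:E).
  apply: eq_integral => D _.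
  have mcD : measurable_fun setT (fun x => c x (inputs D)).
    exact: (measurableT_comp mc2 (pair2_measurable (inputs D))).
  apply: (integral_residual (b := fun x => b (c x (inputs D)))
    (w := fun x => w ord0 (c x (inputs D))) (s := fun x => S x D)) => //.
  - exact: (measurableT_comp mb mcD).
  - exact: (measurableT_comp (mw _) mcD).
  - apply: measurable_sum => i; apply: measurable_funM => //.
    by apply: measurable_funX; exact: (measurableT_comp (mw _) mcD).
rewrite -(fubini_tonelli (m1 := P) (m2 := sample_law P n) (fun v => (b (c v.1.1 (inputs v.2)) ^+ 2
  + (w ord0 (c v.1.1 (inputs v.2)) ^+ 2 * dispersion v.1.1 + S v.1.1 v.2))%:E)); last 2 first.
- apply/measurable_EFinP; apply: measurable_funD.
    by apply: measurable_funX; exact: mcuD.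
  apply: measurable_funD => //; apply: measurable_funM.
    by apply: measurable_funX; exact: mcuD.
  apply: (measurableT_comp measurable_dispersion).
  exact: (measurableT_comp (f := fst)).
- by move=> v; rewrite lee_fin addr_ge0 ?sqr_ge0// addr_ge0// mulr_ge0 ?sqr_ge0 ?dispersion_ge0.
apply: eq_integral => u _; apply: eq_integral => D _; congr EFin.
rewrite big_ord_recl inputsE tnth_0; congr (_ + (_ + _))%R.
by apply: eq_bigr => i _; rewrite tnth_lift.
Qed.

End conditional_variance.

Lemma convex_sq_le (R : realFieldType) (I : finType) (w a : I -> R) : (forall i, 0 <= w i)%R ->
  (\sum_i w i = 1)%R -> ((\sum_i w i * a i) ^+ 2 <= \sum_i w i * a i ^+ 2)%R.
Proof.
move=> w0 w1; set s := (\sum_i w i * a i)%R.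
have : (0 <= \sum_i w i * (a i - s) ^+ 2)%R.
  by apply: sumr_ge0 => i _; rewrite mulr_ge0 ?sqr_ge0.
rewrite (eq_bigr (fun i => w i * a i ^+ 2 - 2 * s * (w i * a i) + s ^+ 2 * w i)%R); last first.
  by move=> i _; ring.
rewrite big_split/= sumrB -!mulr_sumr w1 -/s; lra.
Qed.

Section histogram.
Context {R : realType} {d : nat} {J : finType} (cell : d.-tuple R -> J).
Hypothesis mcell : forall c, measurable [set x | cell x = c].

Local Notation T := (d.-tuple R).
Local Notation Z := (d.-tuple R * R)%type.

Lemma measurable_cell_eq c : measurable_fun [set: T] (fun x => cell x == c).
Proof.
apply: (measurable_fun_bool true); rewrite setTI.
rewrite (_ : _ @^-1` _ = [set x | cell x = c])//.
by apply/seteqP; split => x /=; [move=> /eqP|move=> ->; rewrite eqxx].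
Qed.

Variable n : nat.

(* The [+ (i == ord0)] term makes the weights a probability vector even when
   no input falls in the cell. *)
Definition cell_weight (c : J) (xs : n.+1.-tuple T) (i : 'I_n.+1) : R :=
  (((cell (tnth xs i) == c)%:R + (i == ord0)%:R) *
   (count (fun x => cell x == c) xs).+1%:R^-1)%R.

Lemma cell_weight_ge0 c xs i : (0 <= cell_weight c xs i)%R.
Proof. by rewrite mulr_ge0 ?addr_ge0// invr_ge0. Qed.

Lemma sum_cell_indic c (xs : n.+1.-tuple T) :
  (\sum_(i < n.+1) (cell (tnth xs i) == c)%:R =
   (count (fun x => cell x == c) xs)%:R :> R)%R.
Proof.
rewrite -natr_sum -sum1_count big_tuple [in RHS]big_mkcond/=.
by congr (_%:R)%R; apply: eq_bigr => i _; case: (_ == c).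
Qed.

Lemma sum_cell_weight c xs : (\sum_i cell_weight c xs i = 1)%R.
Proof.
rewrite -mulr_suml big_split/= sum_cell_indic (bigD1 ord0)//= big1 ?addr0.
  by rewrite natr1 mulfV// pnatr_eq0.
by move=> i /negbTE ->.
Qed.

Lemma sum_cell_weight_sq c xs : (\sum_i cell_weight c xs i ^+ 2 <=
  2 * (count (fun x => cell x == c) xs).+1%:R^-1)%R.
Proof.
rewrite -[leRHS]mulr1 -[X in (_ <= _ * X)%R](sum_cell_weight c xs) mulr_sumr.
apply: ler_sum => i _; rewrite expr2 ler_wpM2r ?cell_weight_ge0//.
rewrite ler_wpM2r ?invr_ge0//.
by case: (_ == c); case: (i == _); rewrite /= ?addr0 ?add0r; lra.
Qed.

Lemma measurable_cell_weight c i :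
  measurable_fun [set: n.+1.-tuple T] (fun xs => cell_weight c xs i).
Proof.
apply: measurable_funM.
  apply: measurable_funD => //.
  apply: (measurableT_comp (f := fun b : bool => b%:R : R)) => //.
  by apply: (measurableT_comp (measurable_cell_eq c)); exact: measurable_tnth.
exact: (measurable_fun_count (fun k => k.+1%:R^-1)%R (measurable_cell_eq c)).
Qed.

Definition histogram_cdf (D : n.+1.-tuple Z) (x : T) :
    cumulativeBounded (0 : R)%R (1 : R)%R :=
  sval (mixture_cdf (fun i => (tnth D i).2) (cell_weight_ge0 (cell x) (inputs D))
    (sum_cell_weight (cell x) (inputs D))).

Lemma histogram_cdfE D x z : histogram_cdf D x z =
  (\sum_i cell_weight (cell x) (inputs D) i * ((tnth D i).2 <= z)%R%:R)%R.
Proof. by rewrite /histogram_cdf; case: mixture_cdf. Qed.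

Lemma histogram_cdf_predictor : predictors histogram_cdf.
Proof.
move=> z; under eq_fun do rewrite histogram_cdfE.
apply: measurable_sum => i; apply: measurable_funM; last first.
  apply: (measurableT_comp (f := fun b : bool => b%:R : R)) => //.
  apply: measurable_fun_ler => //; apply: (measurableT_comp (f := snd)) => //.
  by apply: (measurableT_comp (measurable_tnth i)).
rewrite (_ : (fun u => _) = fun u : n.+1.-tuple Z * T => (\sum_c
   (cell u.2 == c)%:R * cell_weight c (inputs u.1) i)%R); last first.
  apply/funext => u; rewrite (bigD1 (cell u.2))//= eqxx mul1r big1 ?addr0//.
  by move=> c; rewrite eq_sym => /negbTE ->; rewrite mul0r.
apply: measurable_sum => c; apply: measurable_funM.
  apply: (measurableT_comp (f := fun b : bool => b%:R : R)) => //.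
  exact: (measurableT_comp (measurable_cell_eq c)).
apply: (measurableT_comp (measurable_cell_weight c i)).
by apply: (measurableT_comp (@measurable_inputs R d _)).
Qed.

End histogram.

Section histogram_risk.
Context {R : realType} {d : nat} {J : finType} (cell : d.-tuple R -> J).
Hypothesis mcell : forall c, measurable [set x | cell x = c].
Context (P : probability (d.-tuple R * R)%type R).
Variable F : d.-tuple R -> cumulativeBounded (0 : R)%R (1 : R)%R.
Hypothesis PF : is_cond_cdf P F.
Variables (M rho Delta : R).
Hypotheses (M0 : (0 <= M)%R) (rho0 : (0 <= rho)%R) (Delta0 : (0 <= Delta)%R).
Hypothesis dispF :
  forall x, \int[lebesgue_measure]_z (F x z * (1 - F x z))%:E <= M%:E.
Hypothesis distF :
  forall x y, \int[lebesgue_measure]_z ((F y z - F x z) ^+ 2)%:E <= Delta%:E.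
Hypothesis dist_cellF : forall x y, cell y = cell x ->
  \int[lebesgue_measure]_z ((F y z - F x z) ^+ 2)%:E <= rho%:E.
Variable n : nat.

Local Notation T := (d.-tuple R).
Local Notation Z := (d.-tuple R * R)%type.

Let count_cell c (D : n.+1.-tuple Z) := count (fun u => cell u.1 == c) D.

Let mcdf (G : cumulativeBounded (0 : R)%R (1 : R)%R) : measurable_fun [set: R] G.
Proof. by apply: nondecreasing_measurable => //; exact: cumulative_is_nondecreasing. Qed.

Let cond_mse x (xs : n.+1.-tuple T) z : R := ((\sum_i cell_weight cell (cell x) xs i *
    (F (tnth xs i) z - F x z)) ^+ 2 +
  \sum_i cell_weight cell (cell x) xs i ^+ 2 * dispersion F z (tnth xs i))%R.

Let cond_mse_ge0 x xs z : (0 <= cond_mse x xs z)%R.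
Proof.
rewrite addr_ge0 ?sqr_ge0// sumr_ge0// => i _.
by rewrite mulr_ge0 ?sqr_ge0 ?dispersion_ge0.
Qed.

Let integral_cond_mse x (xs : n.+1.-tuple T) :
  \int[lebesgue_measure]_z (cond_mse x xs z)%:E <=
  (rho + (Delta + 2 * M) * (count (fun y => cell y == cell x) xs).+1%:R^-1)%:E.
Proof.
pose w := cell_weight cell (cell x) xs.
pose A i z : R := ((F (tnth xs i) z - F x z) ^+ 2)%R.
pose B i z : R := dispersion F z (tnth xs i).
have w0 i : (0 <= w i)%R by exact: cell_weight_ge0.
have A0 i z : (0 <= A i z)%R by exact: sqr_ge0.
have B0 i z : (0 <= B i z)%R by exact: dispersion_ge0.
have mA i : measurable_fun [set: R] (A i).
  by apply: measurable_funX; apply: measurable_funB; exact: mcdf.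
have mB i : measurable_fun [set: R] (B i).
  apply: measurable_funM; first exact: mcdf.
  by apply: measurable_funB => //; exact: mcdf.
have mwA i : measurable_fun [set: R] (fun z => (w i)%:E * (A i z)%:E).
  by apply: measurable_funeM; apply/measurable_EFinP; exact: mA.
have mwB i : measurable_fun [set: R] (fun z => (w i ^+ 2)%:E * (B i z)%:E).
  by apply: measurable_funeM; apply/measurable_EFinP; exact: mB.
have mD : measurable_fun [set: R] (fun z => cond_mse x xs z).
  apply: measurable_funD; last first.
    by apply: measurable_sum => i; apply: measurable_funM => //; exact: mB.
  apply: measurable_funX; apply: measurable_sum => i; apply: measurable_funM => //.
  by apply: measurable_funB; exact: mcdf.
pose IA i := \int[lebesgue_measure]_z (A i z)%:E.
pose IB i := \int[lebesgue_measure]_z (B i z)%:E.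
have IA_fin i : IA i = (fine (IA i))%:E.
  rewrite fineK// ge0_fin_numE; first exact: le_lt_trans (distF _ _) (ltry _).
  by apply: integral_ge0 => z _; rewrite lee_fin.
have IB_fin i : IB i = (fine (IB i))%:E.
  rewrite fineK// ge0_fin_numE; first exact: le_lt_trans (dispF _) (ltry _).
  by apply: integral_ge0 => z _; rewrite lee_fin.
apply: (@le_trans _ _ (\int[lebesgue_measure]_z
    \sum_i ((w i)%:E * (A i z)%:E + (w i ^+ 2)%:E * (B i z)%:E))).
  apply: ge0_le_integral => //.
  - by move=> z _; rewrite lee_fin.
  - exact/measurable_EFinP.
  - by apply: emeasurable_sum => i; apply: emeasurable_funD; [exact: mwA|exact: mwB].
  move=> z _; under eq_bigr do rewrite -!EFinM -EFinD.
  rewrite sumEFin lee_fin big_split/= lerD2r.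
  by apply: convex_sq_le => //; exact: sum_cell_weight.
rewrite ge0_integral_sum//; last 2 first.
- by move=> i; apply: emeasurable_funD; [exact: mwA|exact: mwB].
- by move=> i z _; rewrite -!EFinM -EFinD lee_fin addr_ge0// mulr_ge0 ?sqr_ge0.
rewrite (eq_bigr (fun i => (w i * fine (IA i) + w i ^+ 2 * fine (IB i))%:E)); last first.
  move=> i _; rewrite ge0_integralD//.
  - have -> : \int[lebesgue_measure]_z ((w i)%:E * (A i z)%:E) = (w i)%:E * IA i.
      apply: ge0_integralZl_EFin => //; first by move=> z _; rewrite lee_fin.
      by apply/measurable_EFinP; exact: mA.
    have -> : \int[lebesgue_measure]_z ((w i ^+ 2)%:E * (B i z)%:E) =
        (w i ^+ 2)%:E * IB i.
      apply: ge0_integralZl_EFin; rewrite ?sqr_ge0//.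
        by move=> z _; rewrite lee_fin.
      by apply/measurable_EFinP; exact: mB.
    by rewrite IA_fin IB_fin -!EFinM -EFinD.
  - by move=> z _; rewrite -EFinM lee_fin mulr_ge0.
  - exact: mwA.
  - by move=> z _; rewrite -EFinM lee_fin mulr_ge0 ?sqr_ge0.
  - exact: mwB.
rewrite sumEFin lee_fin big_split/=.
set v := ((count _ xs).+1%:R^-1)%R.
have v0 : (0 <= v)%R by rewrite invr_ge0.
have wA : (\sum_i w i * fine (IA i) <= rho + Delta * v)%R.
  apply: (@le_trans _ _ (\sum_i ((cell (tnth xs i) == cell x)%:R * (v * rho) +
      (i == ord0)%:R * (v * Delta)))%R).
    apply: ler_sum => i _; rewrite /w /cell_weight -/v 2!mulrDl; apply: lerD.
      rewrite -mulrA; case: eqP => [ci|_]; last by rewrite !mul0r.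
      by rewrite !mul1r ler_wpM2l// -lee_fin -IA_fin; exact: dist_cellF.
    rewrite -mulrA ler_wpM2l//.
    by rewrite ler_wpM2l// -lee_fin -IA_fin; exact: distF.
  rewrite big_split/= -!mulr_suml sum_cell_indic (bigD1 ord0)//= big1 ?addr0; last first.
    by move=> i /negbTE ->.
  rewrite mul1r [(v * Delta)%R]mulrC lerD2r mulrA ler_piMl//.
  by rewrite ler_pdivrMr ?ltr0n// mul1r ler_nat.
have wB : (\sum_i w i ^+ 2 * fine (IB i) <= 2 * v * M)%R.
  apply: (@le_trans _ _ (\sum_i w i ^+ 2 * M)%R).
    apply: ler_sum => i _; rewrite ler_wpM2l ?sqr_ge0//.
    by rewrite -lee_fin -IB_fin; exact: dispF.
  by rewrite -mulr_suml ler_wpM2r//; exact: sum_cell_weight_sq.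
by apply: le_trans (lerD wA wB) _; rewrite le_eqVlt; apply/orP; left; apply/eqP; ring.
Qed.

Let integral_histogram_sq x z :
  \int[sample_law P n.+1]_D ((histogram_cdf cell D x z - F x z) ^+ 2)%:E =
  \int[sample_law P n.+1]_D (cond_mse x (inputs D) z)%:E.
Proof.
have mF (i : 'I_n.+1) : measurable_fun setT (fun xs : n.+1.-tuple T => F (tnth xs i) z).
  by apply: (measurableT_comp (PF.1 z)); exact: measurable_tnth.
transitivity (\int[sample_law P n.+1]_D
    (((\sum_i cell_weight cell (cell x) (inputs D) i * (F (tnth (inputs D) i) z - F x z)) +
     \sum_i cell_weight cell (cell x) (inputs D) i * residual F z (tnth D i)) ^+ 2)%:E).
  apply: eq_integral => D _; congr ((_ ^+ 2)%:E).
  rewrite histogram_cdfE -big_split/=.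
  have FxE : F x z = (\sum_i cell_weight cell (cell x) (inputs D) i * F x z)%R.
    by rewrite -mulr_suml sum_cell_weight mul1r.
  rewrite {1}FxE -sumrB.
  by apply: eq_bigr => i _; rewrite /residual tnth_map; ring.
rewrite (@integral_weighted_residuals _ _ P F PF z n.+1
  (fun xs => \sum_i cell_weight cell (cell x) xs i * (F (tnth xs i) z - F x z))%R
  (fun i xs => cell_weight cell (cell x) xs i)).
- apply: eq_integral => D _; congr (_ + _)%:E.
  by apply: eq_bigr => i _; rewrite tnth_map.
- apply: measurable_sum => i; apply: measurable_funM; first exact: measurable_cell_weight.
  exact: measurable_funB.
- by move=> i; exact: measurable_cell_weight.
Qed.

Let integral_histogram_at x :
  \int[lebesgue_measure]_z \int[sample_law P n.+1]_D
    ((histogram_cdf cell D x z - F x z) ^+ 2)%:E <=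
  \int[sample_law P n.+1]_D
    (rho + (Delta + 2 * M) * (count_cell (cell x) D).+1%:R^-1)%:E.
Proof.
under eq_integral do rewrite integral_histogram_sq.
have mfst (i : 'I_n.+1) : measurable_fun setT (fun D : n.+1.-tuple Z => (tnth D i).1).
  by apply: (measurableT_comp (f := fst)) => //; exact: measurable_tnth.
have mw i : measurable_fun setT (fun v : n.+1.-tuple Z * R =>
    cell_weight cell (cell x) (inputs v.1) i).
  apply: (measurableT_comp (measurable_cell_weight mcell (cell x) i)).
  exact: (measurableT_comp (@measurable_inputs R d _)).
have mFi (i : 'I_n.+1) : measurable_fun setT (fun v : n.+1.-tuple Z * R =>
    F (tnth (inputs v.1) i) v.2).
  apply: (measurableT_comp (g := fun v : n.+1.-tuple Z * R => (tnth (inputs v.1) i, v.2))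
    (measurable_cumulative01_uncurry PF.1)).
  apply: measurable_fun_pair => //=; apply: (measurableT_comp (measurable_tnth i)).
  exact: (measurableT_comp (@measurable_inputs R d _)).
have mFx : measurable_fun setT (fun v : n.+1.-tuple Z * R => F x v.2).
  exact: (measurableT_comp (mcdf (F x))).
pose f (v : n.+1.-tuple Z * R) : \bar R := (cond_mse x (inputs v.1) v.2)%:E.
have mf : measurable_fun setT f.
  apply/measurable_EFinP; apply: measurable_funD.
    apply: measurable_funX; apply: measurable_sum => i; apply: measurable_funM => //.
    exact: measurable_funB.
  apply: measurable_sum => i; apply: measurable_funM; first exact: measurable_funX.
  by apply: measurable_funM => //; exact: measurable_funB.
have f0 v : 0 <= f v by rewrite lee_fin.
rewrite -(fubini_tonelli (m1 := sample_law P n.+1) (m2 := lebesgue_measure) f)//.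
apply: ge0_le_integral => //.
- by move=> D _; apply: integral_ge0 => z _; exact: f0.
- exact: (measurable_fun_fubini_tonelli_F (m2 := lebesgue_measure) f).
- apply/measurable_EFinP; apply: measurable_funD => //; apply: measurable_funM => //.
  apply: (measurable_fun_count (fun k => k.+1%:R^-1)%R).
  exact: (measurableT_comp (measurable_cell_eq mcell (cell x))).
move=> D _; apply: le_trans (integral_cond_mse x (inputs D)) _.
by rewrite /count_cell /inputs/= count_map.
Qed.

Lemma histogram_excess_le :
  \int[lebesgue_measure]_z \int[sample_law P n.+1]_D \int[P]_u
    ((histogram_cdf cell D u.1 z - F u.1 z) ^+ 2)%:E <=
  (rho + (Delta + 2 * M) * #|J|%:R / n.+2%:R)%:E.
Proof.
pose f (v : (n.+1.-tuple Z * Z) * R) : \bar R :=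
  ((histogram_cdf cell v.1.1 v.1.2.1 v.2 - F v.1.2.1 v.2) ^+ 2)%:E.
have mf : measurable_fun setT f.
  exact: (measurable_predictor_sq_diff PF (@histogram_cdf_predictor _ _ _ cell mcell n)).
have f0 v : 0 <= f v by rewrite lee_fin sqr_ge0.
rewrite (fubini_tonelli3 (sample_law P n.+1) P lebesgue_measure mf f0).
pose K : R := (Delta + 2 * M)%R.
have K0 : (0 <= K)%R by rewrite addr_ge0// mulr_ge0.
pose p c := fine (\int[P]_u ((cell u.1 == c)%:R)%:E).
have mB c : measurable_fun [set: Z] (fun u => cell u.1 == c).
  exact: (measurableT_comp (measurable_cell_eq mcell c)).
have mBR c : measurable_fun [set: Z] (fun u => (cell u.1 == c)%:R : R).
  exact: (measurableT_comp (f := fun b : bool => b%:R : R) _ (mB c)).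
have pE c : \int[P]_u ((cell u.1 == c)%:R)%:E = (p c)%:E.
  rewrite fineK// ge0_fin_numE; last by apply: integral_ge0 => u _; rewrite lee_fin.
  apply: (@le_lt_trans _ _ 1); last exact: ltry.
  rewrite -[leRHS](integral_cst_probability P); apply: ge0_le_integral => //.
  - exact/measurable_EFinP.
  - by move=> u _; rewrite lee_fin lern1 leq_b1.
pose g (k : nat) : R := (k.+1%:R^-1)%R.
pose e c := binomial_mean (p c) n.+1 g.
have g0 k : (0 <= g k)%R by rewrite invr_ge0.
have eE c : \int[sample_law P n.+1]_D (g (count_cell c D))%:E = (e c)%:E.
  exact: (integral_sample_count n.+1 (mB c) (pE c) g0).
have e0 c : (0 <= e c)%R.
  by rewrite -lee_fin -eE; apply: integral_ge0 => D _; rewrite lee_fin.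
have p01 c : (0 <= p c <= 1)%R.
  rewrite -!lee_fin -pE; apply/andP; split.
    by apply: integral_ge0 => u _; rewrite lee_fin.
  rewrite -[leRHS](integral_cst_probability P); apply: ge0_le_integral => //.
  - exact/measurable_EFinP.
  - by move=> u _; rewrite lee_fin lern1 leq_b1.
apply: (@le_trans _ _ (\int[P]_u (rho%:E + \sum_c (K * e c)%:E * ((cell u.1 == c)%:R)%:E))).
  apply: ge0_le_integral => //.
  - by move=> u _; do 2 (apply: integral_ge0 => ? _); rewrite lee_fin sqr_ge0.
  - pose f' (w : (Z * R) * n.+1.-tuple Z) := f ((w.2, w.1.1), w.1.2).
    have mf' : measurable_fun setT f'.
      apply: (measurableT_comp mf); apply: measurable_fun_pair => /=.
        by apply: measurable_fun_pair => //=; exact: (measurableT_comp (f := fst)).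
      exact: (measurableT_comp (f := snd)).
    apply: (measurable_fun_fubini_tonelli_F (m2 := lebesgue_measure)
      (fubini_F (sample_law P n.+1) f')).
      by apply: measurable_fun_fubini_tonelli_F => // w; exact: f0.
    by move=> w; apply: integral_ge0 => D _; exact: f0.
  - apply: emeasurable_funD => //; apply: emeasurable_sum => c.
    by apply/measurable_EFinP; exact: measurable_funM.
  move=> u _; apply: le_trans (integral_histogram_at u.1) _.
  rewrite (bigD1 (cell u.1))//= eqxx mule1 big1 ?adde0; last first.
    by move=> c; rewrite eq_sym => /negbTE ->; rewrite mule0.
  under eq_integral do rewrite EFinD EFinM.
  rewrite ge0_integralD//; last 2 first.
  - by move=> D _; rewrite -EFinM lee_fin mulr_ge0// g0.
  - apply/measurable_EFinP; apply: measurable_funM => //.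
    exact: (measurable_fun_count g).
  rewrite ge0_integralZl_EFin//; last first.
    apply/measurable_EFinP; exact: (measurable_fun_count g).
  by rewrite (eE (cell u.1)) integral_cst_probability -EFinM.
rewrite ge0_integralD//; last 2 first.
- by move=> u _; apply: sume_ge0 => c _; rewrite -EFinM lee_fin !mulr_ge0.
- by apply: emeasurable_sum => c; apply/measurable_EFinP; exact: measurable_funM.
rewrite integral_cst_probability EFinD leeD2l//.
rewrite ge0_integral_sum//; last 2 first.
- by move=> c; apply/measurable_EFinP; exact: measurable_funM.
- by move=> c u _; rewrite -EFinM lee_fin !mulr_ge0.
rewrite (eq_bigr (fun c => (K * e c * p c)%:E)); last first.
  move=> c _; rewrite ge0_integralZl_EFin ?mulr_ge0//; last first.
    exact/measurable_EFinP.
  by rewrite pE.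
rewrite sumEFin lee_fin.
apply: (@le_trans _ _ (\sum_(c : J) K / n.+2%:R)%R).
  apply: ler_sum => c _; rewrite -mulrA ler_wpM2l//.
  rewrite -[leRHS]mul1r ler_pdivlMr ?ltr0n//.
  apply: le_trans (binomial_mean_inv n.+1 (p01 c)).
  by rewrite -/g -/(e c) le_eqVlt; apply/orP; left; apply/eqP; ring.
by rewrite sumr_const -[leLHS]mulr_natr mulrAC.
Qed.

End histogram_risk.

Lemma minimax_ratio_upper (R : realType) (d : nat) (h C M : R) :
  (0 < h <= 1)%R -> (0 < C)%R -> (0 < M)%R ->
  exists c : R, forall n, (0 < n)%N ->
    minimax_ratio (@holder_class R d h C M) (@minimax_rate R d h) n <= c%:E.
Proof.
move=> h01 C0 M0; have h0 : (0 <= h)%R by case/andP: h01 => /ltW.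
pose Delta : R := ((C * Num.sqrt d%:R `^ h) ^+ 2)%R.
have Delta0 : (0 <= Delta)%R by exact: sqr_ge0.
exists (Delta + (Delta + 2 * M) * (2 ^+ d * 2 ^+ d))%R => -[//|n] n0.
have an0 := @minimax_rate_gt0 R d h n.+1 n0.
have [m [m0 mh_le _ _ md_le]] := @minimax_resolution R d h h01 n.+1 n0.
have mR : (0 < m%:R :> R)%R by rewrite ltr0n.
pose cell := @grid_cell R d m.
have mcell c : measurable [set x | cell x = c] by exact: measurable_grid_cell.
apply: ereal_inf_le; eexists.
  exists (histogram_cdf cell (n := n)); last by reflexivity.
  exact: histogram_cdf_predictor.
apply: ge_ereal_sup => _ [P [Fstar [[cubeP [F [PF FM FC]]] PFstar ->]]].
pose G := F \o clip; have PG : is_cond_cdf P G by exact: cond_cdf_clip.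
have GM x : \int[lebesgue_measure]_z (G x z * (1 - G x z))%:E <= M%:E.
  by apply: FM; exact: clip_cube.
have GC x y (r : R) : (0 <= r)%R -> (enorm (tsub (clip y) (clip x)) <= r)%R ->
    \int[lebesgue_measure]_z ((G y z - G x z) ^+ 2)%:E <= ((C * r `^ h) ^+ 2)%:E.
  move=> r0 xyr; rewrite -Lnorm2_le; last by rewrite mulr_ge0 ?powR_ge0// ltW.
  apply: le_trans (FC _ _ (clip_cube x) (clip_cube y)) _.
  rewrite lee_fin; apply: ler_wpM2l; first exact: ltW.
  by rewrite ge0_ler_powR ?nnegrE ?sqrtr_ge0.
pose rho : R := (Delta * (m%:R `^ h) ^- 2)%R.
have rho0 : (0 <= rho)%R by rewrite mulr_ge0// invr_ge0 sqr_ge0.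
have GDelta x y : \int[lebesgue_measure]_z ((G y z - G x z) ^+ 2)%:E <= Delta%:E.
  apply: GC; first exact: sqrtr_ge0.
  rewrite -[leRHS]mulr1; apply: enorm_le => // i.
  have := clip_cube x i; have := clip_cube y i.
  by move=> /andP[? ?] /andP[? ?]; rewrite ler_norml; lra.
have Grho x y : cell y = cell x ->
    \int[lebesgue_measure]_z ((G y z - G x z) ^+ 2)%:E <= rho%:E.
  move=> xy; have -> : rho = ((C * (Num.sqrt d%:R * m%:R^-1) `^ h) ^+ 2)%R.
    rewrite powRM ?sqrtr_ge0 ?invr_ge0// -[(m%:R^-1)%R]powR_inv1// -powRrM mulN1r powRN.
    by rewrite /rho /Delta mulrA [in RHS]exprMn exprVn.
  apply: GC; first by rewrite mulr_ge0 ?sqrtr_ge0 ?invr_ge0.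
  apply: enorm_le => [|i]; first by rewrite invr_ge0.
  exact: grid_cell_dist.
have := histogram_excess_le mcell PG (ltW M0)
  rho0 Delta0 GM GDelta Grho n.
move=> excess_le.
have risk_fin : risk P G \is a fin_num.
  rewrite ge0_fin_numE; first exact: le_lt_trans (risk_le PG GM) (ltry _).
  by do 2 (apply: integral_ge0 => ? _); rewrite lee_fin sqr_ge0.
rewrite (risk_cond_cdf_eq PFstar PG) (expected_risk_decomp PG); last first.
  exact: histogram_cdf_predictor.
rewrite addeAC subee// add0e inver gt_eqF// lee_pdivrMr//.
apply: le_trans excess_le _; rewrite -EFinM lee_fin.
rewrite [leRHS]mulrDl; apply: lerD; first by rewrite ler_wpM2l.
rewrite -!mulrA; apply: ler_wpM2l; first by rewrite addr_ge0// mulr_ge0// ltW.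
rewrite ler_pdivrMr ?ltr0n// card_ffun !card_ord natrX.
apply: (@le_trans _ _ ((2 * m%:R) ^+ d)%R).
  apply: lerXn2r; rewrite ?nnegrE ?mulr_ge0//.
  by rewrite -natr1; have : (1 <= m%:R :> R)%R by [rewrite ler1n]; lra.
rewrite exprMn -!mulrA ler_wpM2l ?exprn_ge0//.
apply: le_trans md_le _; rewrite ler_wpM2l ?exprn_ge0// mulrC.
by rewrite ler_wpM2l ?ler_nat// ltW.
Qed.

Theorem theorem1 (R : realType) (d : nat) (h C M : R) :
  (1 <= d)%N -> (0 < h <= 1)%R -> (0 < C)%R -> (0 < M)%R ->
  let a (n : nat) : R :=
    (n%:R `^ (- ((2 * h) / (2 * h + d%:R))))%R in
  0 < limn_einf (minimax_ratio (@holder_class R d h C M) a) /\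
  limn_esup (minimax_ratio (@holder_class R d h C M) a) < +oo.
Proof.
move=> _ h01 C0 M0 a; split.
  have [c c0 le_c] := minimax_ratio_lower d h01 C0 M0.
  apply: (@lt_le_trans _ _ c%:E); first by rewrite lte_fin.
  exact: limn_einf_ge.
have [c le_c] := minimax_ratio_upper d h01 C0 M0.
by apply: (@le_lt_trans _ _ c%:E); [exact: limn_esup_le|exact: ltry].
Qed.
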